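(* Let $\varepsilon>0$. Let $M\in\mathbb{Z}$, $Q,N\in\mathbb{N}$, and let $(a_n)_{n=M+1}^{M+N}$ be arbitrary complex numbers. Put $S(x)=\sum_{n=M+1}^{M+N} a_n e(xn)$ and $Z=\sum_{n=M+1}^{M+N}|a_n|^2$. Then \[ \sum_{q\le Q}\ \sum_{\substack{a=1\\(a,q)=1}}^{q^2}\left|S\!\left(\frac{a}{q^2}\right)\right|^2 \ll (QN)^{\varepsilon}\left(Q^3+N+\min\{N\sqrt{Q},\sqrt{N}Q^2\}\right)Z, \] where the implied constant depends on $\varepsilon$ alone.
   Context: $e(x)=e^{2\pi i x}$. *)

(* Defs.v *)
From mathcomp Require Import all_boot all_order all_algebra.
From mathcomp Require Import complex.
From mathcomp Require Import all_classical all_reals all_analysis.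

Set Implicit Arguments.
Unset Strict Implicit.
Unset Printing Implicit Defensive.

Import Order.TTheory GRing.Theory Num.Theory.

Local Open Scope ring_scope.
Local Open Scope complex_scope.

(* The circle map e(x) = exp(2 pi i x), through Euler's formula. *)
Definition circ (R : realType) (x : R) : R[i] :=
  cos (2 * pi * x) +i* sin (2 * pi * x).

(* The order and norm of R[i] make [`|z|] an element of R[i] with null
   imaginary part; this is the same modulus as an element of R. *)
Definition modulus (R : realType) (z : R[i]) : R := complex.Re `|z|.

(* The summation index is n = M + k with 1 <= k <= N; the coefficients outside
   [M + 1, M + N] play no role. *)
Definition expsum (R : realType) (M : int) (N : nat) (a : int -> R[i])
    (x : R) : R[i] :=
  \sum_(1 <= k < N.+1) a (M + k%:Z) * circ (x * (M + k%:Z)%:~R).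

Definition sqnorm (R : realType) (M : int) (N : nat) (a : int -> R[i]) : R :=
  \sum_(1 <= k < N.+1) modulus (a (M + k%:Z)) ^+ 2.

(* Main.v *)
(* By duality (X = sum |S(x_i)|^2 is a linear form in the a_n with coefficients
   built from the S(x_i)) and the positive kernel |sum_(s < L) e(s x)|^2 with
   L = 2N, the left side is at most a constant times N K Z, where K bounds, for
   every y, the number of fractions b/q^2 (mod 1) within 1/N of y.

   K is counted elementarily. Put a = b + t q^2, so that |a - y q^2| <= q^2/N,
   and let y = c/r + z by Dirichlet. The integer m = a r - c q^2 is close to
   r z q^2. If m = 0, coprimality forces r = q^2. If m <> 0, for fixed m the q
   solve a quadratic congruence mod r (about d(r) classes) in an interval of
   length about Q/(N|z| + 1), and summing over m gives
   K << d(r) (1 + r |z| Q^2 + r Q^2/N + Q^3/N).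
   Taking r <= sqrt N gives the term Q^2/sqrt N. Taking r <= Q^(3/2) gives
   sqrt Q as long as r <= Q; for Q < r <= Q^(3/2), Weyl differencing of
   sum_q e(l y q^2) gives K << (QN)^eps (sqrt Q + Q^3/N). *)

Require Import Defs.
From mathcomp Require Import all_boot all_order all_algebra.
From mathcomp Require Import complex.
From mathcomp Require Import all_classical all_reals all_analysis.
From mathcomp Require Import zify ring lra.

Set Implicit Arguments.
Unset Strict Implicit.
Unset Printing Implicit Defensive.

Import Order.TTheory GRing.Theory Num.Theory.
Import numFieldNormedType.Exports.

Local Open Scope ring_scope.

(** * The divisor bound *)

(** The threshold Q^(3/2) balances two ranges of r. Dirichlet gives r |z| << Q^(-3/2), hence r |z|
    Q^2 << sqrt Q, but r Q^2/N is harmless only for r <= Q. For larger r, Weyl differencing with L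
    of size N/Q^2 gives, up to divisor and logarithmic factors, Q^3/N + sqrt(Q + r/L). Now r <=
    Q^(3/2) makes r/L at most a constant times sqrt Q times Q^3/N, so the root is << sqrt Q + Q^3/N.
    If N is below a constant times Q^2 no such L exists, but then counting the a for each q
    separately already costs only Q^3/N.

    The obstacle in the congruence count is that q^2 = c mod r may have about sqrt r solutions when
    c and r share a square factor, as for c = 0 and r a square. No bound by d(r) holds for a single
    m; the count has to weigh the excess of solutions against the number of m that allow it. *)

Lemma size_divisors (n : nat) :
  size (divisors n) = (\prod_(f <- prime_decomp n) f.2.+1)%N.
Proof.
rewrite /divisors; elim: (prime_decomp n) => [|[p e] s IHs]; first by rewrite big_nil.
rewrite big_cons /= -IHs; elim: e => [|e IHe] /=; first by rewrite mul1n.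
by rewrite size_merge size_cat size_map IHe [RHS]mulSn addnC.
Qed.

(* Primes above [2 ^ (1 / e)] contribute a factor at most 1 to d(n) / n^e. *)
Lemma divisors_bound (R : realType) (e : R) : 0 < e ->
  exists2 C : R, 1 <= C &
    forall n : nat, (0 < n)%N -> (size (divisors n))%:R <= C * powR n%:R e.
Proof.
move=> e0.
have ln2 : 0 < ln (2 : R) by rewrite ln_gt0// ltr1n.
(* With u = e ln 2, p^(k e) >= exp(k u) >= 1 + k u, and (1 + 1/u)(1 + k u) >= k + 1: one factor [B]
   serves every exponent at a small prime. *)
pose B : R := 1 + (e * ln 2)^-1.
have B1 : 1 <= B by rewrite lerDl invr_ge0 mulr_ge0 ?ltW.
pose P := (Num.truncn (powR (2 : R) e^-1)).+1.
pose g (p : nat) : R := if (p < P)%N then B else 1.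
have g1 p : 1 <= g p by rewrite /g; case: ifP.
exists (B ^+ P); first exact: exprn_ege1.
move=> n n0.
have pow_exp (p : nat) k : powR (p ^ k)%:R e = (powR p%:R e) ^+ k.
  by rewrite natrX -powR_mulrn ?powR_ge0// powRAC powR_mulrn// powR_ge0.
have factor (p k : nat) : prime p -> k.+1%:R <= g p * powR (p ^ k)%:R e.
  move=> pp; rewrite pow_exp /g; case: ifP => pP.
    have : powR 2 e ^+ k <= powR p%:R e ^+ k.
      by apply: lerXn2r; rewrite ?nnegrE ?powR_ge0//; apply: ge0_ler_powR; rewrite ?nnegrE ?ler0n ?ler_nat ?prime_gt1// ltW.
    move=> /(ler_wpM2l (le_trans ler01 B1)); apply: le_trans.
    have -> : powR (2 : R) e ^+ k = expR (k%:R * (e * ln 2)).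
      by rewrite expRM_natl /powR pnatr_eq0.
    have := expR_ge1Dx (k%:R * (e * ln 2)).
    move=> /(ler_wpM2l (le_trans ler01 B1)); apply: le_trans.
    have el0 : e * ln 2 != 0 by rewrite mulf_neq0 ?gt_eqF.
    have -> : B * (1 + k%:R * (e * ln 2)) = k.+1%:R + (e * ln 2)^-1 + k%:R * (e * ln 2).
      by rewrite /B -natr1; move: (e * ln 2) el0 => u u0; field.
    have el1 : 0 <= e * ln 2 by rewrite mulr_ge0 ?ltW.
    by rewrite -addrA lerDl addr_ge0 ?invr_ge0// mulr_ge0.
  rewrite mul1r.
  have : 2 ^+ k <= powR p%:R e ^+ k.
    apply: lerXn2r; rewrite ?nnegrE ?powR_ge0//.
    have -> : 2 = powR (powR (2 : R) e^-1) e.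
      by rewrite -powRrM mulVf ?gt_eqF// powRr1.
    apply: ge0_ler_powR; rewrite ?nnegrE ?powR_ge0 ?ler0n ?ltW//.
    by apply: (lt_le_trans (truncnS_gt _)); rewrite ler_nat leqNgt pP.
  apply: le_trans; rewrite -natrX ler_nat; exact: ltn_expl.
have prod_pos (s : seq (nat * nat)) : all (fun f => prime f.1) s ->
    (\prod_(f <- s) f.2.+1)%:R <=
    \prod_(f <- s) g f.1 * powR (\prod_(f <- s) f.1 ^ f.2)%:R e.
  elim: s => [|f s IHs] /=; first by rewrite !big_nil powR1 mulr1.
  move=> /andP[pf /IHs h]; rewrite !big_cons !natrM powRM// mulrACA.
  by apply: ler_pM; rewrite ?ler0n ?factor.
have pdP : all (fun f : nat * nat => prime f.1) (prime_decomp n).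
  by apply/allP => -[p k] /mem_prime_decomp[].
rewrite size_divisors {2}(prod_prime_decomp n0).
apply: (le_trans (prod_pos _ pdP)); apply: ler_wpM2r; first exact: powR_ge0.
rewrite -(big_map fst predT g) /=.
have -> : [seq f.1 | f <- prime_decomp n] = primes n by [].
have : B ^+ (count (fun p => (p < P)%N) (primes n)) <= B ^+ P.
  apply: ler_weXn2l => //; rewrite -size_filter.
  rewrite -[leqRHS](size_iota 0); apply: uniq_leq_size.
    by rewrite filter_uniq// primes_uniq.
  by move=> p; rewrite mem_filter mem_iota add0n => /andP[].
apply: le_trans; rewrite le_eqVlt; apply/orP; left; apply/eqP.
elim: (primes n) => [|p s IHs]; first by rewrite big_nil.
by rewrite big_cons IHs /g /=; case: ifP => _; rewrite ?mul1r// exprS.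
Qed.

Lemma harmonic_ln (R : realType) (n : nat) :
  \sum_(1 <= d < n.+1) (d%:R)^-1 <= 1 + ln (n%:R : R).
Proof.
case: n => [|n]; first by rewrite big_geq// ln0// addr0.
elim: n => [|n IHn]; first by rewrite big_nat1 ln1 invr1 addr0.
rewrite big_nat_recr//=.
have n10 : 0 < n.+1%:R :> R by rewrite ltr0n.
have n20 : 0 < n.+2%:R :> R by rewrite ltr0n.
have : ln (n.+1%:R / n.+2%:R) <= - (n.+2%:R : R)^-1.
  have -> : n.+1%:R / n.+2%:R = 1 - (n.+2%:R : R)^-1.
    rewrite (_ : n.+1%:R = n.+2%:R - 1) ?mulrBl ?divff ?gt_eqF ?mul1r//.
    by rewrite -[n.+2%:R]natr1 addrK.
  by apply: le_ln1Dx; rewrite ltrN2 invf_lt1// ltr1n.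
rewrite ln_div ?posrE// => h; apply: (le_trans (lerD IHn (lexx _))). by move: (n.+2%:R^-1) h => u; lra.
Qed.

(** The inequality ln y < y at y = n^e gives ln n <= n^e / e, so that logarithms disappear into the
    factor (QN)^eps. *)
Lemma harmonic_bound (R : realType) (e : R) : 0 < e ->
  exists2 C : R, 0 <= C & forall n : nat, (0 < n)%N ->
    \sum_(1 <= d < n.+1) (d%:R)^-1 <= C * powR n%:R e.
Proof.
move=> e0; exists (1 + e^-1) => [|n n0]; first by rewrite addr_ge0// invr_ge0 ltW.
apply: (le_trans (harmonic_ln _ _)).
have n1 : 1 <= n%:R :> R by rewrite ler1n.
have h1 : 1 <= powR n%:R e.
  have := @ge0_ler_powR R e (ltW e0) 1 n%:R; rewrite powR1 !nnegrE; exact.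
have := ln_sublinear (lt_le_trans ltr01 h1); rewrite ln_powR => /ltW.
by rewrite mulrDl mul1r -ler_pdivlMl// mulrC => ?; apply: lerD.
Qed.

(** * Diophantine approximation and spaced points *)

(** Pigeonhole: the fractional parts of i x for 0 <= i <= tau fall into tau cells of length
    1/tau. *)
Lemma dirichlet_approx (R : realType) (x : R) (tau : nat) : (0 < tau)%N ->
  exists (r : nat) (b : int), [/\ (0 < r <= tau)%N, coprimez b r &
    `|r%:R * x - b%:~R| <= tau%:R^-1].
Proof.
case: tau => // t _; pose fr (i : nat) : R := i%:R * x - (Num.floor (i%:R * x))%:~R.
have fr01 i : 0 <= fr i < 1.
  by have := floor_itv (i%:R * x); rewrite /fr intrD => /andP[]; lra.
have t0 : 0 < t.+1%:R :> R by rewrite ltr0n.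
have cell i : (Num.truncn (t.+1%:R * fr i) < t.+1)%N.
  have /andP[f0 f1] := fr01 i.
  by rewrite truncn_lt_nat ?mulr_ge0// gtr_pMr.
pose f (i : 'I_t.+2) : 'I_t.+1 := Ordinal (cell i).
have [i [j [ij fij]]] : exists i j : 'I_t.+2, (i < j)%N /\ f i = f j.
  have : ~~ injectiveb f.
    apply/negP => /injectiveP /leq_card; by rewrite !card_ord ltnn.
  case/injectivePn => i [j ij fij]; case: (ltngtP i j) => h.
  - by exists i, j.
  - by exists j, i.
  - by rewrite (val_inj h) eqxx in ij.
pose k := (j - i)%N; pose c := Num.floor (j%:R * x) - Num.floor (i%:R * x).
have k0 : (0 < k)%N by rewrite subn_gt0.
have kc : `|k%:R * x - c%:~R| <= t.+1%:R^-1.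
  have -> : k%:R * x - c%:~R = fr j - fr i.
    by rewrite /fr /c /k natrB ?(ltnW ij)// intrB; ring.
  have /andP[fi0 _] := fr01 i; have /andP[fj0 _] := fr01 j.
  have /(congr1 val) /= e := fij.
  have /andP[i1 i2] := truncn_itv (mulr_ge0 (ltW t0) fi0).
  have /andP[j1 j2] := truncn_itv (mulr_ge0 (ltW t0) fj0).
  rewrite -e in j1 j2; rewrite -[(Num.truncn _).+1%:R]natr1 in i2 j2.
  rewrite -(ler_pM2l t0) divff ?gt_eqF// -{1}(gtr0_norm t0) -normrM mulrBr ler_norml.
  by lra.
(* Cancelling the common factor divides |k x - c| by it as well, so the bound survives the passage
   to lowest terms. *)
pose g := gcdz c k.
have g0 : 0 < g by rewrite lt_neqAle eq_sym gcdz_eq0 negb_and (_ : k%:Z != 0) ?orbT// -lt0n.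
have [r rE] : exists r : nat, k = (r * `|g|)%N.
  have /dvdzP[q qk] := dvdz_gcdr c k.
  exists `|q|%N; by rewrite -abszM -qk.
have [b bE] : exists b, c = b * g by apply/dvdzP; exact: dvdz_gcdl.
have r0 : (0 < r)%N by move: k0; rewrite rE; case: (r).
have g1 : (0 < `|g|)%N by rewrite absz_gt0 gt_eqF.
have gE : g = `|g|%:Z by rewrite gez0_abs// ltW.
exists r, b; split.
- rewrite r0 /=; apply: (@leq_trans k); first by rewrite rE leq_pmulr.
  by rewrite /k leq_subLR (leq_trans _ (leq_addl _ _))// -ltnS.
- have : gcdz (b * g) (r%:Z * g) = g by rewrite -bE {2}gE -PoszM -rE.
  rewrite /coprimez -mulz_gcdl -gE => h.
  by apply/eqP; apply: (mulIf (lt0r_neq0 g0)); rewrite h mul1r.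
- apply: le_trans kc.
  have -> : k%:R * x - c%:~R = `|g|%:R * (r%:R * x - b%:~R).
    by rewrite rE bE gE natrM intrM -pmulrn absz_nat; ring.
  by rewrite normrM normr_nat ler_peMl// ler1n.
Qed.

Lemma spaced_card (R : realType) (I : finType) (A : {set I}) (f : I -> R) (s w : R) :
  0 < s -> 0 <= w ->
  {in A &, forall i j, i != j -> s <= `|f i - f j|} ->
  {in A &, forall i j, f i - f j <= w} ->
  #|A|%:R <= 1 + w / s.
Proof.
move=> s0 w0 sp wd.
have [->|[i0 i0A]] := set_0Vmem A.
  by rewrite cards0 addr_ge0// divr_ge0// ltW.
case: (arg_minP f i0A) => m mA mmin.
pose g i := Num.truncn ((f i - f m) / s).
have dge0 i : i \in A -> 0 <= (f i - f m) / s.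
  by move=> iA; rewrite divr_ge0 ?(ltW s0)// subr_ge0 mmin.
have gbound i : i \in A -> (g i < (Num.truncn (w / s)).+1)%N.
  move=> iA; rewrite ltnS le_truncn// ler_pM2r ?invr_gt0//; exact: wd.
have ginj : {in A &, injective g}.
  move=> i j iA jA gij; apply/eqP; apply: contraT => ij.
  have := sp i j iA jA ij.
  have /andP[i1 i2] := truncn_itv (dge0 i iA).
  have /andP[j1 j2] := truncn_itv (dge0 j jA).
  rewrite -/(g i) -/(g j) -gij in i1 i2 j1 j2; rewrite -[(Num.truncn _).+1%:R]natr1 in i2 j2.
  have e : (f i - f j) = s * ((f i - f m) / s - (f j - f m) / s).
    by field; rewrite gt_eqF.
  rewrite e normrM (gtr0_norm s0) -{1}(mulr1 s) ler_pM2l// ler_normr; lra.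
have : (#|A| <= (Num.truncn (w / s)).+1)%N.
  rewrite -(card_ord (Num.truncn (w / s)).+1).
  rewrite -(card_in_imset (f := fun i => inord (g i) : 'I_(Num.truncn (w/s)).+1)).
    exact: max_card.
  move=> i j iA jA /(congr1 val); rewrite /= !inordK ?gbound//; exact: ginj.
rewrite -(ler_nat R) => /le_trans; apply; rewrite -natr1 addrC lerD2l truncn_le.
by rewrite divr_ge0// ltW.
Qed.

(** * Sums over points of the circle *)

Lemma sin_ge_mul_cos (R : realType) (x : R) : 0 <= x <= pi -> x * cos x <= sin x.
Proof.
move=> /andP[]; rewrite le_eqVlt => /predU1P[<- _|x0 xpi]; first by rewrite mul0r sin0.
have [c /andP[c0 cx] e] : exists2 c : R, c \in `]0, x[%R & sin x - sin 0 = cos c * (x - 0).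
  apply: MVT => //.
  by apply: continuous_subspaceT => y; exact: continuous_sin.
rewrite !bnd_simp in c0 cx.
move: e; rewrite sin0 !subr0 mulrC => ->; rewrite ler_pM2l//.
by rewrite ltW// ltr_cos// in_itv /=; apply/andP; split; lra.
Qed.

(** The triple-angle formula turns cos(pi/2) = 0 into c (1 - 4 s^2) = 0 with c and s positive. *)
Lemma sin_pi6 (R : realType) : sin (pi / 6 : R) = 2^-1.
Proof.
have s0 : 0 < sin (pi / 6 : R) by apply: sin_gt0_pi; have := pi_gt0 R; lra.
have c0 : 0 < cos (pi / 6 : R) by apply: cos_gt0_pihalf; have := pi_gt0 R; lra.
have e3 : pi / 6 + (pi / 6 + pi / 6) = pi / 2 :> R by field.
have : cos (pi / 6 + (pi / 6 + pi / 6) : R) = 0 by rewrite e3 cos_pihalf.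
rewrite cosD cosD sinD.
have := cos2Dsin2 (pi / 6 : R).
move: (sin _) (cos _) s0 c0 => s c s0 c0 h1 h2.
have h3 : c * (1 - 4 * s ^+ 2) = 0.
  by have : c * (c ^+ 2 - 3 * s ^+ 2) = 0; [rewrite -h2; ring | rewrite (_ : c ^+ 2 = 1 - s ^+ 2); [move=> <-; ring | lra]].
have /eqP : 1 - 4 * s ^+ 2 = 0.
  by apply/eqP; move/eqP: h3; rewrite mulf_eq0 gt_eqF.
rewrite (_ : 1 - 4 * s ^+ 2 = (1 - 2 * s) * (1 + 2 * s)); last ring.
by rewrite mulf_eq0 => /orP[] /eqP; lra.
Qed.

Lemma cos_pi3 (R : realType) : cos (pi / 3 : R) = 2^-1.
Proof.
by rewrite -(sin_pi6 R) -cosBpihalf -cosN; congr cos; field.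
Qed.

(** Concavity would give 2 x; the weaker x is enough and has a short proof. Up to 1/3 the cosine is
    at least 1/2 and [sin_ge_mul_cos] applies; beyond, the sine exceeds sin(pi/6) = 1/2. *)
Lemma sin_pi_ge (R : realType) (x : R) : 0 <= x <= 2^-1 -> x <= sin (pi * x).
Proof.
move=> /andP[x0 x2]; have pi0 := pi_gt0 R; have pi2 := pi_ge2 R.
have [x3|x3] := leP x 3^-1.
  have px : 0 <= pi * x by rewrite mulr_ge0// ltW.
  have px3 : pi * x <= pi / 3 by rewrite ler_pM2l.
  have := @sin_ge_mul_cos R (pi * x); rewrite px /= => h; apply: le_trans (h _); last by lra.
  have : 2^-1 <= cos (pi * x).
    rewrite -cos_pi3; move: px3; rewrite le_eqVlt => /predU1P[-> //|px3].
    by rewrite ltW// ltr_cos// in_itv /=; apply/andP; split; lra.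
  by move=> hc; nra.
apply: (le_trans x2); rewrite -sin_pi6.
have px3 : pi / 6 < pi * x by rewrite ltr_pM2l//; lra.
have px2 : pi * x <= pi / 2 by rewrite ler_pM2l.
by rewrite ltW// ltr_sin// in_itv /=; apply/andP; split; lra.
Qed.

Lemma sinD_pi_int (R : realType) (x : R) (t : int) :
  `|sin (pi * (x + t%:~R))| = `|sin (pi * x)|.
Proof.
have nat_case (y : R) (n : nat) : `|sin (pi * (y + n%:R))| = `|sin (pi * y)|.
  elim: n => [|n IHn]; first by rewrite addr0.
  by rewrite -natr1 addrA mulrDr mulr1 sinDpi normrN.
case: t => n; first exact: nat_case.
by rewrite NegzE mulrNz -(nat_case _ n.+1) -pmulrn subrK.
Qed.

Lemma cosD_2pi_int (R : realType) (x : R) (t : int) :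
  cos (2 * pi * (x + t%:~R)) = cos (2 * pi * x).
Proof.
have nat_case (y : R) (n : nat) : cos (2 * pi * (y + n%:R)) = cos (2 * pi * y).
  elim: n => [|n IHn]; first by rewrite addr0.
  by rewrite -[n.+1%:R]natr1 addrA mulrDr mulr1 mulr_natl cosD2pi -mulr_natl.
case: t => n; first exact: nat_case.
by rewrite NegzE mulrNz -(nat_case _ n.+1) -pmulrn subrK.
Qed.

(** The hypothesis bounds the distance from x to the nearest integer from below; a translate of x
    lies in [-1/2, 1/2], where [sin_pi_ge] applies. *)
Lemma sin_pi_far (R : realType) (x c : R) :
  (forall t : int, c <= `|x + t%:~R|) -> c <= `|sin (pi * x)|.
Proof.
move=> far; pose t := - Num.floor (x + 2^-1).
have /andP[f0 f1] := floor_itv (x + 2^-1); rewrite intrD in f1.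
rewrite -(sinD_pi_int _ t); apply: (le_trans (far t)).
have : - 2^-1 <= x + t%:~R <= 2^-1 by rewrite /t mulrNz; lra.
move: (x + _) => y /andP[y1 y2].
have [y0|y0] := leP 0 y; first by rewrite ger0_norm// (le_trans _ (ler_norm _))// sin_pi_ge// y0.
rewrite ltr0_norm// -normrN -sinN -mulrN (le_trans _ (ler_norm _))// sin_pi_ge//; lra.
Qed.

(** The circle is cut into n cells of length 1/n, each holding at most K points. A given distance
    d/n from the integers is charged to two cells, one on each side of 0, whence the factor 2. This
    serves both the kernel sum of the large sieve and the sum of reciprocal sines in Weyl's
    method. *)
Lemma cell_sum (R : realType) (I : finType) (A : {set I}) (y : I -> R) (n : nat)
    (K : R) (G : I -> R) (g : nat -> R) : (0 < n)%N -> (forall d, 0 <= g d) ->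
  (forall x, #|[set i in A | `[< exists t : int, `|y i + t%:~R - x| <= n%:R^-1 >]]|%:R <= K) ->
  (forall i d, i \in A -> (forall t : int, d%:R / n%:R <= `|y i + t%:~R|) -> G i <= g d) ->
  \sum_(i in A) G i <= 2 * K * \sum_(d < n) g d.
Proof.
case: n => // n _ g0 HK HG.
pose fr i : R := y i - (Num.floor (y i))%:~R.
have n0 : 0 < n.+1%:R :> R by rewrite ltr0n.
have fr01 i : 0 <= fr i < 1.
  by have := floor_itv (y i); rewrite /fr intrD => /andP[]; lra.
have cellP i : (Num.truncn (n.+1%:R * fr i) < n.+1)%N.
  by have /andP[f0 f1] := fr01 i; rewrite truncn_lt_nat ?mulr_ge0 ?(ltW n0)// gtr_pMr.
pose c i : 'I_n.+1 := Ordinal (cellP i).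
have cP i : (c i)%:R / n.+1%:R <= fr i < (c i).+1%:R / n.+1%:R.
  have /andP[f0 f1] := fr01 i.
  have /andP[] := truncn_itv (mulr_ge0 (ltW n0) f0).
  by rewrite ler_pdivrMr// ltr_pdivlMr// ![fr i * _]mulrC => -> ->.
(* There are n + 1 cells here; the right end of cell c is (c + 1)/(n + 1), at distance (n - c)/(n +
   1) from 1. *)
have far i : forall t : int, (minn (c i) (n - c i))%:R / n.+1%:R <= `|y i + t%:~R|.
  move=> t; have /andP[f0 f1] := cP i.
  have -> : y i + t%:~R = fr i + (Num.floor (y i) + t)%:~R by rewrite /fr intrD; ring.
  have [t0|t0] := leP 0 (Num.floor (y i) + t).
    apply: (le_trans _ (ler_norm _)); apply: (@le_trans _ _ (fr i)); last by rewrite lerDl ler0z.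
    by apply: le_trans f0; rewrite ler_pM2r ?invr_gt0// ler_nat geq_minl.
  have t1 : (Num.floor (y i) + t)%:~R <= -1 :> R.
    by rewrite -(mulrN1z 1) ler_int; move: t0; lia.
  rewrite -normrN; apply: (le_trans _ (ler_norm _)).
  apply: (@le_trans _ _ (1 - fr i)); last by lra.
  have : (minn (c i) (n - c i))%:R / n.+1%:R <= (n - c i)%:R / n.+1%:R :> R.
    by rewrite ler_pM2r ?invr_gt0// ler_nat geq_minr.
  have -> : (n - c i)%:R / n.+1%:R = 1 - (c i).+1%:R / n.+1%:R :> R.
    rewrite -subSS natrB ?ltn_ord// mulrBl divff ?gt_eqF//.
  by move=> /le_trans; apply; rewrite lerD2l lerN2 ltW.
have K0 : 0 <= K by apply: le_trans (HK 0).
apply: (@le_trans _ _ (\sum_(i in A) g (minn (c i) (n - c i)))).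
  by apply: ler_sum => i iA; apply: HG.
rewrite (partition_big c predT)//.
apply: (@le_trans _ _ (\sum_(k < n.+1) K * (g k + g (n - k)%N))).
  apply: ler_sum => k _.
  rewrite (eq_bigr (fun=> g (minn k (n - k)))); last by move=> i /andP[_ /eqP <-].
  rewrite sumr_const -[X in X <= _]mulr_natl.
  apply: ler_pM; rewrite ?ler0n//; last first.
    by rewrite /minn; case: ifP => _; rewrite ?lerDl ?lerDr.
  apply: le_trans (HK (k%:R / n.+1%:R)); rewrite ler_nat.
  apply: subset_leq_card; apply/fintype.subsetP => i; rewrite !inE => /andP[-> /eqP ck] /=.
  apply/asboolP; exists (- Num.floor (y i)); rewrite mulrNz -/(fr i).
  have /andP[] := cP i; rewrite ck -[k.+1%:R]natr1 mulrDl mul1r => h1 h2.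
  by rewrite ger0_norm ?subr_ge0 // lerBlDl (ltW h2).
rewrite -mulr_sumr big_split/= [X in _ + X](reindex_inj rev_ord_inj)/=.
rewrite (eq_bigr (fun k : 'I_n.+1 => g k)) => [|//].
rewrite [X in _ + X](eq_bigr (fun k : 'I_n.+1 => g k)); last first.
  by move=> k _; rewrite subSS subKn// -ltnS.
rewrite le_eqVlt; apply/orP; left; apply/eqP; ring.
Qed.

(** * The large sieve *)

(** Multiplication by 2 sin(pi x) telescopes the sum. The product form remains valid where the sine
    vanishes. The phase [phi] yields sine sums at -pi/2 and carries the constant term of a
    differenced quadratic phase. *)
Lemma cos_sum_le (R : realType) (x phi : R) (n : nat) :
  `|\sum_(k < n) cos (2 * pi * (k%:R * x) + phi)| * `|sin (pi * x)| <= 1.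
Proof.
have tele : 2 * sin (pi * x) * (\sum_(k < n) cos (2 * pi * (k%:R * x) + phi)) =
    sin (2 * pi * (n%:R * x) + phi - pi * x) - sin (phi - pi * x).
  elim: n => [|n IHn]; first by rewrite big_ord0 mul0r mulr0 mulr0 add0r subrr.
  rewrite big_ord_recr /= mulrDr IHn.
  have -> : 2 * pi * (n.+1%:R * x) + phi - pi * x = (2 * pi * (n%:R * x) + phi) + pi * x.
    by rewrite -[n.+1%:R]natr1; ring.
  move: (2 * pi * (n%:R * x) + phi) => B; rewrite (sinB B) (sinD B). ring.
have : `|2 * sin (pi * x) * (\sum_(k < n) cos (2 * pi * (k%:R * x) + phi))| <= 2.
  rewrite tele; apply: (le_trans (ler_normB _ _)).
  by have := sin_max (2 * pi * (n%:R * x) + phi - pi * x); have := sin_max (phi - pi * x); lra.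
by rewrite !normrM normr_nat; lra.
Qed.

(** The squared modulus of the one-sided Dirichlet kernel, that is, L times the Fejer kernel. *)
Definition dirichlet_kernel (R : realType) (L : nat) (x : R) : R :=
  (\sum_(s < L) cos (2 * pi * (s%:R * x))) ^+ 2 +
  (\sum_(s < L) sin (2 * pi * (s%:R * x))) ^+ 2.

Lemma dirichlet_kernel_ge0 (R : realType) L (x : R) : 0 <= dirichlet_kernel L x.
Proof. by rewrite addr_ge0 ?sqr_ge0. Qed.

Lemma dirichlet_kernelE (R : realType) L (x : R) :
  \sum_(s < L) \sum_(t < L) cos (2 * pi * ((s%:R - t%:R) * x)) = dirichlet_kernel L x.
Proof.
rewrite /dirichlet_kernel !expr2 !big_distrlr -big_split /=.
apply: eq_bigr => s _; rewrite -big_split /=; apply: eq_bigr => t _.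
by rewrite mulrBl mulrBr cosB.
Qed.

(** Exchanging s and t changes the sign. This is the imaginary part of the expanded kernel, so real
    forms suffice below. *)
Lemma dirichlet_kernel_sin (R : realType) L (x : R) :
  \sum_(s < L) \sum_(t < L) sin (2 * pi * ((s%:R - t%:R) * x)) = 0.
Proof.
have : \sum_(s < L) \sum_(t < L) sin (2 * pi * ((s%:R - t%:R) * x)) =
     - \sum_(s < L) \sum_(t < L) sin (2 * pi * ((s%:R - t%:R) * x)).
  rewrite [LHS]exchange_big -sumrN; apply: eq_bigr => s _ /=.
  rewrite -sumrN; apply: eq_bigr => t _.
  by rewrite -sinN -mulrN -mulNr opprB.
by move: (\sum_(s < L) _) => S; lra.
Qed.

Lemma dirichlet_kernelN (R : realType) L (x : R) :
  dirichlet_kernel L (- x) = dirichlet_kernel L x.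
Proof.
rewrite -!dirichlet_kernelE; apply: eq_bigr => s _; apply: eq_bigr => t _.
by rewrite -cosN -mulrN -mulrN opprK.
Qed.

Lemma dirichlet_kernel_max (R : realType) L (x : R) :
  dirichlet_kernel L x <= L%:R ^+ 2.
Proof.
rewrite -dirichlet_kernelE.
apply: (@le_trans _ _ (\sum_(s < L) \sum_(t < L) 1)).
  by apply: ler_sum => s _; apply: ler_sum => t _; apply: cos_le1.
by rewrite !sumr_const card_ord -mulrnA natrM expr2.
Qed.

Lemma dirichlet_kernel_far (R : realType) L (x c : R) : 0 < c ->
  c <= `|sin (pi * x)| -> dirichlet_kernel L x <= 2 / c ^+ 2.
Proof.
move=> c0 cx; rewrite ler_pdivlMr ?exprn_gt0// /dirichlet_kernel mulrDl -!exprMn.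
have sq (y : R) : `|y| * `|sin (pi * x)| <= 1 -> (y * c) ^+ 2 <= 1.
  move=> h; rewrite -[(y * c) ^+ 2]real_normK ?num_real// normrM (gtr0_norm c0).
  rewrite -(expr1n _ 2) lerXn2r ?nnegrE ?mulr_ge0 ?(ltW c0)//.
  by apply: le_trans h; rewrite ler_wpM2l.
(* The phase -pi/2 turns the cosine sum into the sine sum; each square contributes at most 1/c^2. *)
have h1 := sq _ (cos_sum_le x (- (pi / 2)) L); have h2 := sq _ (cos_sum_le x 0 L).
move: h1 h2; rewrite (eq_bigr _ (fun k _ => cosBpihalf _)).
under [X in _ -> (X * c) ^+ 2 <= _ -> _]eq_bigr => k _ do rewrite addr0.
by move=> h1 h2; move: (lerD h2 h1); rewrite (_ : 1 + 1 = 2).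
Qed.

(** Within 1/(6L) of an integer all L phases stay within pi/3 of a multiple of 2 pi, so every cosine
    is at least 1/2. *)
Lemma dirichlet_kernel_near (R : realType) (L : nat) (x : R) (t : int) :
  `|x + t%:~R| * (6 * L%:R) <= 1 -> L%:R ^+ 2 / 4 <= dirichlet_kernel L x.
Proof.
move=> h; have pi0 := pi_gt0 R.
have : L%:R / 2 <= \sum_(s < L) cos (2 * pi * (s%:R * x)).
  rewrite (_ : L%:R / 2 = \sum_(s < L) 2^-1); last first.
    by rewrite sumr_const card_ord -[RHS]mulr_natl.
  apply: ler_sum => s _.
  rewrite -(cosD_2pi_int _ (s%:Z * t)) intrM -mulrDr -cos_norm.
  have e : `|2 * pi * (s%:R * (x + t%:~R))| <= pi / 3.
    rewrite !normrM normr_nat (gtr0_norm pi0) normr_nat.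
    have sL : s%:R <= L%:R :> R by rewrite ler_nat ltnW.
    have := ler_wpM2l (normr_ge0 (x + t%:~R)) sL.
    by have := normr_ge0 (x + t%:~R); nra.
  rewrite -cos_pi3; move: e; rewrite le_eqVlt => /predU1P[-> //|e].
  by rewrite ltW// ltr_cos// in_itv /= ?normr_ge0; [lra | apply/andP; split; lra].
have L0 : 0 <= L%:R / 2 :> R by rewrite divr_ge0.
move=> h1; rewrite /dirichlet_kernel.
have := @lerXn2r R 2 _ _ _ _ h1; rewrite !nnegrE L0 (le_trans L0 h1) => /(_ isT isT).
rewrite (_ : (L%:R / 2) ^+ 2 = L%:R ^+ 2 / 4); last by field.
by move=> h2; apply: (le_trans h2); rewrite lerDl sqr_ge0.
Qed.

Lemma sum_inv_sqr_le2 (R : realType) (n : nat) :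
  \sum_(d < n) (d.+1%:R ^+ 2)^-1 <= 2 :> R.
Proof.
have : \sum_(d < n.+1) (d.+1%:R ^+ 2)^-1 <= 2 - n.+1%:R^-1 :> R.
  elim: n => [|n IHn]; first by rewrite big_ord1 expr1n invr1; lra.
  rewrite big_ord_recr /=; apply: (le_trans (lerD IHn (lexx _))).
  have n1 : 0 < n.+1%:R :> R by rewrite ltr0n.
  rewrite -[n.+2%:R]natr1; move: (n.+1%:R : R) n1 => y y0.
  have -> : (2 : R) - y^-1 + ((y + 1) ^+ 2)^-1 = 2 - (y + 1)^-1 - (y * (y + 1) ^+ 2)^-1.
    by field; rewrite !gt_eqF//; lra.
  by rewrite gerBl invr_ge0 mulr_ge0 ?sqr_ge0 ?ltW.
rewrite big_ord_recr /=.
have : 0 <= (n.+1%:R ^+ 2)^-1 :> R by rewrite invr_ge0 sqr_ge0.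
have : 0 <= n.+1%:R^-1 :> R by rewrite invr_ge0.
move: (n.+1%:R^-1) ((n.+1%:R ^+ 2)^-1) => a b; lra.
Qed.

(** For each t < N the shift s = t + k with 1 <= k <= N stays below 2N, so every such k is met at
    least N times as a difference. This is what fixes the kernel length 2N. *)
Lemma sum_shift_le (R : realType) (N : nat) (W : R -> R) : (forall x, 0 <= W x) ->
  N%:R * (\sum_(1 <= k < N.+1) W k%:R) <=
  \sum_(s < N + N) \sum_(t < N + N) W (s%:R - t%:R).
Proof.
move=> W0; rewrite exchange_big big_split_ord /= -[leLHS]addr0.
apply: lerD; last by apply: sumr_ge0 => t _; apply: sumr_ge0.
rewrite mulr_natl -[X in _ *+ X](card_ord N) -sumr_const; apply: ler_sum => t _.
rewrite -(big_mkord predT (fun s => W (s%:R - t%:R))) /=.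
have tN : (t.+1 <= N + N)%N by rewrite ltn_addr.
have tN2 : (N + t.+1 <= N + N)%N by rewrite leq_add2l.
rewrite (big_cat_nat (leq0n t.+1) tN) (big_cat_nat (leq_addl N t.+1) tN2) /=.
have -> : \sum_(1 <= k < N.+1) W k%:R = \sum_(t.+1 <= s < N + t.+1) W (s%:R - t%:R).
  rewrite -{1}(add1n t) big_addn addnS -addSn addnK.
  by apply: eq_bigr => k _; rewrite natrD addrK.
by rewrite addrCA lerDl addr_ge0 ?sumr_ge0.
Qed.

(** With c_i = p_i + i q_i the two squares form |sum c_i e(-n x_i)|^2 at n = s - t. Summation over s
    and t gives a Hermitian form whose matrix is the nonnegative symmetric kernel at x_i - x_j;
    bounding |c_i c_j| by the mean of |c_i|^2 and |c_j|^2 leaves its row sums (Schur test). *)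
Lemma large_sieve_kernel (R : realType) (I : finType) (A : {set I}) (x p q : I -> R) (L : nat) :
  \sum_(s < L) \sum_(t < L)
    ((\sum_(i in A) (p i * cos (2 * pi * ((s%:R - t%:R) * x i)) + q i * sin (2 * pi * ((s%:R - t%:R) * x i)))) ^+ 2
   + (\sum_(i in A) (q i * cos (2 * pi * ((s%:R - t%:R) * x i)) - p i * sin (2 * pi * ((s%:R - t%:R) * x i)))) ^+ 2)
  <= \sum_(i in A) (p i ^+ 2 + q i ^+ 2) * \sum_(j in A) dirichlet_kernel L (x j - x i).
Proof.
pose F i j (n : R) := (p i * p j + q i * q j) * cos (2 * pi * (n * (x i - x j)))
   + (p i * q j - q i * p j) * - sin (2 * pi * (n * (x i - x j))).
have expand (n : R) :
    (\sum_(i in A) (p i * cos (2 * pi * (n * x i)) + q i * sin (2 * pi * (n * x i)))) ^+ 2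
   + (\sum_(i in A) (q i * cos (2 * pi * (n * x i)) - p i * sin (2 * pi * (n * x i)))) ^+ 2
   = \sum_(i in A) \sum_(j in A) F i j n.
  rewrite !expr2 !big_distrlr -big_split /=.
  apply: eq_bigr => i _; rewrite -big_split /=; apply: eq_bigr => j _.
  by rewrite /F mulrBr !mulrBr cosB sinB; ring.
under eq_bigr => s _ do under eq_bigr => t _ do rewrite expand.
under eq_bigr => s _.
  rewrite exchange_big /=; under eq_bigr => i _ do rewrite exchange_big /=; over.
rewrite exchange_big /=; under eq_bigr => i _ do rewrite exchange_big /=.
have collapse i j : \sum_(s < L) \sum_(t < L) F i j (s%:R - t%:R) =
    (p i * p j + q i * q j) * dirichlet_kernel L (x i - x j).
  under eq_bigr => s _ do rewrite big_split -!mulr_sumr sumrN /=.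
  rewrite big_split /= -!mulr_sumr sumrN dirichlet_kernelE dirichlet_kernel_sin.
  by rewrite oppr0 mulr0 addr0.
under eq_bigr => i _ do under eq_bigr => j _ do rewrite collapse.
pose D i j := dirichlet_kernel L (x j - x i).
have DC i j : D i j = D j i by rewrite /D -dirichlet_kernelN opprB.
have D0 i j : 0 <= D i j by apply: dirichlet_kernel_ge0.
apply: (@le_trans _ _ (\sum_(i in A) \sum_(j in A)
    (2^-1 * ((p i ^+ 2 + q i ^+ 2) * D i j) + 2^-1 * ((p j ^+ 2 + q j ^+ 2) * D i j)))).
  apply: ler_sum => i _; apply: ler_sum => j _.
  rewrite -/(D j i) DC -mulrDr -mulrDl mulrA; apply: ler_wpM2r => //.
  have := sqr_ge0 (p i - p j); have := sqr_ge0 (q i - q j); rewrite !sqrrB; lra.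
under [leLHS]eq_bigr => i _ do rewrite big_split /=.
rewrite [leLHS]big_split /= [X in _ + X]exchange_big /=.
under [X in _ + X]eq_bigr => i _ do under eq_bigr => j _ do rewrite DC.
rewrite -big_split /= le_eqVlt; apply/orP; left; apply/eqP.
apply: eq_bigr => i _; rewrite -!mulr_sumr; lra.
Qed.

Lemma large_sieve_real (R : realType) (I : finType) (A : {set I}) (x : I -> R)
    (N : nat) (K : R) (u v : nat -> R) : (0 < N)%N -> 0 < K ->
  (forall y, #|[set i in A | `[< exists t : int, `|x i + t%:~R - y| <= N%:R^-1 >]]|%:R <= K) ->
  \sum_(i in A)
    ((\sum_(1 <= k < N.+1) (u k * cos (2 * pi * (k%:R * x i)) - v k * sin (2 * pi * (k%:R * x i)))) ^+ 2
   + (\sum_(1 <= k < N.+1) (v k * cos (2 * pi * (k%:R * x i)) + u k * sin (2 * pi * (k%:R * x i)))) ^+ 2)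
  <= 32 * K * N%:R * \sum_(1 <= k < N.+1) (u k ^+ 2 + v k ^+ 2).
Proof.
move=> N0 K0 HK.
have N0R : 0 < N%:R :> R by rewrite ltr0n.
pose p i := \sum_(1 <= k < N.+1) (u k * cos (2 * pi * (k%:R * x i)) - v k * sin (2 * pi * (k%:R * x i))).
pose q i := \sum_(1 <= k < N.+1) (v k * cos (2 * pi * (k%:R * x i)) + u k * sin (2 * pi * (k%:R * x i))).
(* Here p_i + i q_i = S(x_i), and T(n) + i U(n) = sum_i S(x_i) e(-n x_i) is the dual sum. *)
pose T (n : R) := \sum_(i in A) (p i * cos (2 * pi * (n * x i)) + q i * sin (2 * pi * (n * x i))).
pose U (n : R) := \sum_(i in A) (q i * cos (2 * pi * (n * x i)) - p i * sin (2 * pi * (n * x i))).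
pose X := \sum_(i in A) (p i ^+ 2 + q i ^+ 2).
rewrite -/X; set Z := \sum_(1 <= k < N.+1) (u k ^+ 2 + v k ^+ 2).
have XE : X = \sum_(1 <= k < N.+1) (u k * T k%:R + v k * U k%:R).
  rewrite /X (eq_bigr (fun i => \sum_(1 <= k < N.+1)
    (u k * (p i * cos (2 * pi * (k%:R * x i)) + q i * sin (2 * pi * (k%:R * x i)))
    + v k * (q i * cos (2 * pi * (k%:R * x i)) - p i * sin (2 * pi * (k%:R * x i)))))); last first.
    move=> i _; rewrite !expr2 {2}/p {2}/q !mulr_sumr -big_split /=.
    by apply: eq_bigr => k _; ring.
  rewrite exchange_big /=; apply: eq_bigr => k _.
  by rewrite big_split /= -!mulr_sumr.
have kersum i : i \in A -> \sum_(j in A) dirichlet_kernel (N + N) (x j - x i) <= 32 * K * N%:R ^+ 2.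
  (* For d >= 1 the kernel is at most 2 (N/d)^2, and d + 1 <= 2d replaces d by d + 1 at the cost of
     4, which makes d = 0 a regular term: there the maximum (2N)^2 is below 8 N^2. With the 2K of
     [cell_sum] and the series bound 2 this gives 32. *)
  move=> iA; pose g (d : nat) : R := 8 * N%:R ^+ 2 * (d.+1%:R ^+ 2)^-1.
  apply: (@le_trans _ _ (2 * K * \sum_(d < N) g d)).
    apply: (cell_sum (y := fun j => x j - x i) N0).
    - by move=> d; rewrite /g !mulr_ge0 ?sqr_ge0// invr_ge0 sqr_ge0.
    - move=> y; apply: le_trans (HK (y + x i)); rewrite ler_nat.
      apply: subset_leq_card; apply/fintype.subsetP => j; rewrite !inE => /andP[-> /=].
      move=> /asboolP[t ht]; apply/asboolP; exists t.
      by rewrite (_ : x j + t%:~R - (y + x i) = x j - x i + t%:~R - y)//; ring.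
    - move=> j d jA far; rewrite /g; case: d far => [_|d far].
        apply: (le_trans (dirichlet_kernel_max _ _)).
        by rewrite expr1n invr1 natrD mulr1; have := sqr_ge0 (N%:R : R); lra.
      have c0 : 0 < d.+1%:R / N%:R :> R by rewrite divr_gt0 ?ltr0n.
      apply: (le_trans (dirichlet_kernel_far _ c0 (sin_pi_far far))).
      rewrite (_ : 2 / (d.+1%:R / N%:R) ^+ 2 = 8 * N%:R ^+ 2 * (4 * d.+1%:R ^+ 2)^-1); last first.
        by field; rewrite !gt_eqF// ltr0n.
      apply: ler_wpM2l; first by rewrite mulr_ge0 ?sqr_ge0.
      rewrite lef_pV2 ?posrE ?mulr_gt0 ?exprn_gt0 ?ltr0n//.
      rewrite -!natrX -natrM ler_nat; nia.
  rewrite /g -mulr_sumr; have := sum_inv_sqr_le2 R N.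
  move: (\sum_(d < N) _) => S S2.
  have : 0 <= 16 * K * N%:R ^+ 2 by rewrite !mulr_ge0 ?sqr_ge0 ?ltW.
  by move=> /ler_wpM2l /(_ _ _ S2); lra.
have TU : \sum_(1 <= k < N.+1) (T k%:R ^+ 2 + U k%:R ^+ 2) <= 32 * K * N%:R * X.
  rewrite -(ler_pM2l N0R).
  apply: (le_trans (@sum_shift_le R N (fun n => T n ^+ 2 + U n ^+ 2) _)).
    by move=> n; rewrite addr_ge0 ?sqr_ge0.
  apply: (le_trans (large_sieve_kernel _ _ _ _ _)).
  apply: (@le_trans _ _ (\sum_(i in A) (p i ^+ 2 + q i ^+ 2) * (32 * K * N%:R ^+ 2))).
    by apply: ler_sum => i iA; rewrite ler_wpM2l ?kersum// addr_ge0 ?sqr_ge0.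
  by rewrite -mulr_suml -/X le_eqVlt; apply/orP; left; apply/eqP; ring.
have D0 : 0 < 32 * K * N%:R by rewrite !mulr_gt0.
move: (32 * K * N%:R) D0 TU => D D0 TU.
(* The weights are chosen so that the second term is X/2 and moves to the left side. *)
suff : X <= D / 2 * Z + (2 * D)^-1 * (D * X).
  have -> : (2 * D)^-1 * (D * X) = X / 2 by field; rewrite gt_eqF.
  lra.
apply: (@le_trans _ _ (D / 2 * Z + (2 * D)^-1 * \sum_(1 <= k < N.+1) (T k%:R ^+ 2 + U k%:R ^+ 2))); last first.
  by rewrite lerD2l ler_wpM2l// invr_ge0 mulr_ge0// ltW.
rewrite {1}XE /Z !mulr_sumr -big_split /=; apply: ler_sum => k _.
(* AM-GM instead of Cauchy-Schwarz: no square root appears. *)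
have amgm (a b : R) : a * b <= D / 2 * a ^+ 2 + (2 * D)^-1 * b ^+ 2.
  have -> : D / 2 * a ^+ 2 + (2 * D)^-1 * b ^+ 2 = a * b + (D * a - b) ^+ 2 * (2 * D)^-1.
    by field; rewrite gt_eqF.
  by rewrite lerDl mulr_ge0 ?sqr_ge0// invr_ge0 mulr_ge0// ltW.
by have := amgm (u k) (T k%:R); have := amgm (v k) (U k%:R); lra.
Qed.

(** * Squares close to a rational *)

(** After division by d, the cofactor e is coprime to (x - y)/d, so it must divide the other factor
    x + y. *)
Lemma dvdz_sqr_diff_gcd (r x y : int) (d := gcdz r (x - y)) (e := (r %/ d)%Z) :
  r != 0 -> (r %| x ^+ 2 - y ^+ 2)%Z ->
  [/\ r = d * e, (d %| x - y)%Z & (e %| x + y)%Z].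
Proof.
move=> r0 rxy; have rE : r = d * e by rewrite mulrC divzK// dvdz_gcdl.
split => //; first exact: dvdz_gcdr.
have d0 : d != 0 by rewrite gcdz_eq0 negb_and r0.
have /dvdzP[k kE] : (d %| x - y)%Z by exact: dvdz_gcdr.
have cop : coprimez e k.
  have : gcdz (e * d) (k * d) = d by rewrite [e * d]mulrC -rE -kE.
  rewrite -mulz_gcdl gez0_abs// => h.
  by apply/eqP; apply: (mulIf d0); rewrite h mul1r.
move: rxy; rewrite (_ : x ^+ 2 - y ^+ 2 = d * (k * (x + y))); last by rewrite subr_sqr kE; ring.
by rewrite [X in (X %| _)%Z]rE dvdz_mul2l// Gauss_dvdzr.
Qed.

(** With e = r/d, both x and y are t mod d and -t mod e. So they agree modulo lcm(d, e) = r/D. *)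
Lemma sqr_class_spacing (r x y t d : int) (D := gcdz d (r %/ d)%Z) :
  0 < r -> (r %| x ^+ 2 - t ^+ 2)%Z -> (r %| y ^+ 2 - t ^+ 2)%Z ->
  gcdz r (x - t) = d -> gcdz r (y - t) = d -> x != y ->
  r <= `|x - y| * D.
Proof.
move=> r0 rx ry dx dy xy; have rn0 := lt0r_neq0 r0.
have := dvdz_sqr_diff_gcd rn0 rx; rewrite dx => -[rE dxt ext].
have := dvdz_sqr_diff_gcd rn0 ry; rewrite dy => -[_ dyt eyt].
rewrite -/D; set e := (r %/ d)%Z in D rE ext eyt *.
have D0 : D != 0 by rewrite gcdz_eq0 negb_and -negb_and; apply: contraNN rn0; rewrite rE => /andP[/eqP -> _]; rewrite mul0r.
have h1 : (d %| x - y)%Z by have := rpredB dxt dyt; rewrite (_ : x - t - (y - t) = x - y); last ring.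
have h2 : (e %| x - y)%Z by have := rpredB ext eyt; rewrite (_ : x + t - (y + t) = x - y); last ring.
have h3 : (r %| (x - y) * D)%Z.
  have [u [v uv]] := Bezoutz d e.
  have -> : D = u * d + v * e by rewrite uv.
  rewrite mulrDr rE rpredD//.
    by rewrite mulrCA dvdz_mull// mulrC dvdz_mul.
  by rewrite mulrCA dvdz_mull// dvdz_mul.
move: h3; rewrite dvdzE => h3; move: h3.
move/dvdn_leq; rewrite absz_gt0 mulf_neq0 ?subr_eq0// => /(_ isT).
by rewrite abszM -lez_nat PoszM !abszE (gtr0_norm r0) (ger0_norm (_ : 0 <= D)).
Qed.

(** D divides x - t and x + t, hence 2x. For m = a r - b x^2 this forces D^2 to divide 4m, the
    constraint that compensates the loss of D in the spacing. *)
Lemma sqr_class_gcd_dvd (r x t : int) (d := gcdz r (x - t)) (D := gcdz d (r %/ d)%Z) :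
  r != 0 -> (r %| x ^+ 2 - t ^+ 2)%Z -> (D ^+ 2 %| r)%Z && (D ^+ 2 %| 4 * x ^+ 2)%Z.
Proof.
move=> r0 rx; have [rE dxt ext] := dvdz_sqr_diff_gcd r0 rx.
rewrite -/d in rE dxt ext; apply/andP; split.
  by rewrite [X in (_ %| X)%Z]rE expr2 dvdz_mul ?dvdz_gcdl ?dvdz_gcdr.
rewrite (_ : 4 * x ^+ 2 = (2 * x) ^+ 2); last ring.
apply: dvdz_exp2r => //; rewrite (_ : 2 * x = (x - t) + (x + t)); last ring.
by rewrite rpredD// (dvdz_trans _ dxt, dvdz_trans _ ext) ?dvdz_gcdl ?dvdz_gcdr.
Qed.

(** Subtracting the two approximations and cancelling r (x + y) gives (x - y) |z| <= (x + y) nu <= 2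
    Q nu. Adding the trivial (x - y) nu <= Q nu yields 3 and keeps the bound meaningful at z = 0. *)
Lemma near_window_width (R : realType) (r z x y Q nu m : R) :
  0 < r -> 0 < nu -> 0 < y -> y < x -> x <= Q ->
  `|m - r * z * x ^+ 2| <= r * (x ^+ 2 * nu) -> `|m - r * z * y ^+ 2| <= r * (y ^+ 2 * nu) ->
  (x - y) * (`|z| + nu) <= 3 * Q * nu.
Proof.
move=> r0 nu0 y0 yx xQ hx hy.
have xy0 : 0 < x + y by lra.
have d0 : 0 < x - y by lra.
have : `|(m - r * z * y ^+ 2) - (m - r * z * x ^+ 2)| <= r * (y ^+ 2 * nu) + r * (x ^+ 2 * nu).
  by apply: (le_trans (ler_normB _ _)); rewrite lerD.
rewrite (_ : _ - (m - _) = (r * (x + y)) * ((x - y) * z)); last ring.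
rewrite normrM (gtr0_norm (mulr_gt0 r0 xy0)) normrM (gtr0_norm d0) => h.
have h2 : (x - y) * `|z| <= (x + y) * nu.
  rewrite -(ler_pM2l (mulr_gt0 r0 xy0)); apply: (le_trans h).
  rewrite -subr_ge0 (_ : _ - _ = 2 * (r * nu * x * y)); last ring.
  by rewrite !mulr_ge0// ltW// (lt_trans y0).
have h3 : (x + y) * nu <= 2 * Q * nu by rewrite ler_pM2r//; lra.
have h4 : (x - y) * nu <= Q * nu by rewrite ler_pM2r//; lra.
by rewrite mulrDr; lra.
Qed.

(* Classify the [q] with given [m] by [d = gcd(r, q - q0)], [q0] a fixed solution
   for the same [m]. With [D = gcd(d, r / d)] such [q] are [r / D]-spaced, while
   [D ^ 2] divides [4 m]; the scarcity of these [m] pays for the loss of [D]. *)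
Lemma rational_count (R : realType) (I : finType) (A : {set I}) (q : I -> nat) (a : I -> int)
    (Q N r : nat) (b : int) (z : R) :
  (0 < N)%N -> (0 < r)%N -> coprimez b r ->
  {in A &, forall i j, q i = q j -> a i = a j -> i = j} ->
  {in A, forall i, (0 < q i <= Q)%N} ->
  {in A, forall i, coprimez (a i) (q i)} ->
  {in A, forall i, `|(a i)%:~R - (b%:~R / r%:R + z) * (q i)%:R ^+ 2| <= (q i)%:R ^+ 2 / N%:R} ->
  #|A|%:R <= 1 + (size (divisors r))%:R *
    (3 * (r%:R * Q%:R ^+ 2 * (`|z| + N%:R^-1)) + 36 * (Q%:R ^+ 3 / N%:R)).
Proof.
move=> N0 r0 br inj qQ cop near.
have N0R : 0 < N%:R :> R by rewrite ltr0n.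
have NV0 : 0 < N%:R^-1 :> R by rewrite invr_gt0.
have r0R : 0 < r%:R :> R by rewrite ltr0n.
have r0z : 0 < r%:Z by rewrite ltz_nat.
pose m i : int := a i * r%:Z - b * (q i)%:Z ^+ 2.
have mE i : (m i)%:~R - r%:R * z * (q i)%:R ^+ 2 =
    r%:R * ((a i)%:~R - (b%:~R / r%:R + z) * (q i)%:R ^+ 2).
  by rewrite /m !expr2 intrB !intrM -!pmulrn; field; rewrite gt_eqF.
have m_near i : i \in A -> `|(m i)%:~R - r%:R * z * (q i)%:R ^+ 2| <= r%:R * ((q i)%:R ^+ 2 / N%:R).
  by move=> iA; rewrite mE normrM normr_nat ler_wpM2l// near.
pose W := `|z| + N%:R^-1; have W0 : 0 < W by rewrite ltr_wpDl.
pose M := r%:R * Q%:R ^+ 2 * W.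
have M0 : 0 <= M by rewrite /M !mulr_ge0 ?sqr_ge0 ?(ltW W0).
have mM i : i \in A -> `|(m i)%:~R| <= M.
  move=> iA; have h := m_near i iA.
  have /andP[_ qiQ] := qQ i iA.
  have q2 : (q i)%:R ^+ 2 <= Q%:R ^+ 2 :> R by rewrite lerXn2r ?nnegrE// ler_nat.
  have : `|(m i)%:~R| <= r%:R * (q i)%:R ^+ 2 * W.
    have := ler_normD ((m i)%:~R - r%:R * z * (q i)%:R ^+ 2) (r%:R * z * (q i)%:R ^+ 2).
    rewrite subrK => h2; apply: (le_trans h2).
    rewrite [X in _ + X]normrM [X in _ + X * _]normrM normr_nat (ger0_norm (sqr_ge0 _)) /W; lra.
  move=> h2; apply: (le_trans h2); rewrite /M ler_pM2r// ler_pM2l//.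
pose A0 := [set i in A | m i == 0]; pose A1 := [set i in A | m i != 0].
have A01 : #|A| = (#|A0| + #|A1|)%N.
  rewrite -(cardsID [set i | m i == 0] A); congr (_ + _)%N.
    by apply: eq_card => i; rewrite /A0 !inE.
  by apply: eq_card => i; rewrite /A1 !inE andbC.
(* If a r = b q^2, the two coprimality conditions give r = q^2; this fixes q, and then a. *)
have A0le : (#|A0| <= 1)%N.
  have m0 i : i \in A0 -> (r = q i ^ 2)%N.
    rewrite inE => /andP[iA]; rewrite subr_eq0 => /eqP e.
    apply/eqP; rewrite eqn_dvd; apply/andP; split.
      have : (r%:Z %| b * (q i)%:Z ^+ 2)%Z by rewrite -e dvdz_mull.
      by rewrite Gauss_dvdzr 1?coprimezE 1?coprime_sym// dvdzE abszX.
    have : ((q i)%:Z ^+ 2 %| a i * r%:Z)%Z by rewrite e dvdz_mull.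
    rewrite Gauss_dvdzr; first by rewrite dvdzE abszX.
    by rewrite coprimezE abszX coprime_pexpl// coprime_sym -coprimezE cop.
  apply/card_le1_eqP => i j iA0 jA0.
  have /m0 ei := iA0; have /m0 ej := jA0.
  have qij : q i = q j by apply/eqP; rewrite -(eqn_exp2r _ _ (isT : (0 < 2)%N)) -ei -ej.
  move: iA0 jA0; rewrite !inE => /andP[iA /eqP mi] /andP[jA /eqP mj].
  apply: inj => //; apply: (mulIf (lt0r_neq0 r0z)).
  by move: mi mj; rewrite /m qij => /eqP + /eqP; rewrite !subr_eq0 => /eqP -> /eqP ->.
have A1A i : i \in A1 -> i \in A by rewrite inE => /andP[].
(* On [A1] the choice depends on m only, by [rep_eq]; the default i is never reached there, since i
   itself qualifies. *)
pose rep i := odflt i [pick j in A1 | m j == m i].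
have repP i : i \in A1 -> rep i \in A1 /\ m (rep i) = m i.
  move=> iA1; rewrite /rep; case: pickP => [j /andP[jA /eqP]//|/(_ i)].
  by rewrite iA1 eqxx.
have rep_eq i j : i \in A1 -> j \in A1 -> m i = m j -> rep i = rep j.
  move=> iA1 jA1 mij; rewrite /rep mij; case: pickP => // /(_ j).
  by rewrite jA1 eqxx.
pose dd i : nat := gcdn r `|(q i)%:Z - (q (rep i))%:Z|.
have ddz i : (dd i)%:Z = gcdz r ((q i)%:Z - (q (rep i))%:Z) by [].
have sqr_dvd i : i \in A1 -> (r%:Z %| (q i)%:Z ^+ 2 - (q (rep i))%:Z ^+ 2)%Z.
  move=> iA1; have [_ e] := repP i iA1.
  rewrite -(@Gauss_dvdzr _ b); last by rewrite /coprimez gcdzC.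
  rewrite (_ : b * _ = (a i - a (rep i)) * r%:Z); first by rewrite dvdz_mull.
  by move: e; rewrite /m; lia.
have diam i j : i \in A -> j \in A -> m i = m j ->
    (q i)%:R - (q j)%:R <= 3 * Q%:R / N%:R / W :> R.
  move=> iA jA mij; rewrite ler_pdivlMr//.
  have /andP[qi0 qi] := qQ i iA; have /andP[qj0 qj] := qQ j jA.
  have [h|h] := leP ((q i)%:R : R) (q j)%:R.
    by apply: (@le_trans _ _ 0); rewrite ?mulr_le0_ge0 ?subr_le0 ?(ltW W0)// !mulr_ge0// ltW.
  have := m_near i iA; have := m_near j jA; rewrite -mij => hj hi.
  have qiR : (q i)%:R <= Q%:R :> R by rewrite ler_nat.
  have qj0R : 0 < (q j)%:R :> R by rewrite ltr0n.
  exact: (near_window_width r0R NV0 qj0R h qiR hi hj).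
have fiber (d : nat) : #|[set i in A1 | dd i == d]|%:R <= 3 * M + 36 * (Q%:R ^+ 3 / N%:R).
  set Ad := [set i in A1 | dd i == d].
  have AdP i : i \in Ad -> i \in A1 /\ dd i = d by rewrite inE => /andP[-> /eqP].
  have rhs0 : 0 <= 3 * M + 36 * (Q%:R ^+ 3 / N%:R).
    by rewrite addr_ge0// mulr_ge0// mulr_ge0 ?invr_ge0 ?exprn_ge0.
  have [->|[i0 i0A]] := set_0Vmem Ad; first by rewrite cards0.
  pose D := gcdz d (r%:Z %/ d)%Z.
  have D2m i : i \in Ad -> (D ^+ 2 %| 4 * m i)%Z.
    move=> /AdP[iA1 di]; have := sqr_class_gcd_dvd (lt0r_neq0 r0z) (sqr_dvd i iA1).
    rewrite -ddz di -/D => /andP[Dr Dq].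
    rewrite (_ : 4 * m i = 4 * a i * r%:Z - b * (4 * (q i)%:Z ^+ 2)); last by rewrite /m; ring.
    by rewrite rpredB// dvdz_mull.
  have m1 i : i \in A1 -> 1 <= `|(m i)%:~R| :> R.
    by rewrite inE => /andP[_ mi]; rewrite -intr_norm ler1z -gtz0_ge1 normr_gt0.
  have D1 : 1 <= D%:~R :> R.
    rewrite ler1z -gtz0_ge1 lt_neqAle eq_sym gcdz_eq0 negb_and; apply/andP; split => //.
    have [_ <-] := AdP _ i0A; apply/orP; left.
    by rewrite -lt0n gcdn_gt0 r0.
  have D0 : 0 < D%:~R :> R by apply: lt_le_trans D1.
  have D2le (k : int) : k != 0 -> (D ^+ 2 %| 4 * k)%Z -> D%:~R ^+ 2 / 4 <= `|k%:~R| :> R.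
    move=> k0 /dvdn_leq; rewrite absz_gt0 mulf_neq0// => /(_ isT).
    rewrite -lez_nat !abszE normrX (ger0_norm (_ : 0 <= D))// normrM -(ler_int R).
    by rewrite rmorphXn /= intrM [X in _ * X]intr_norm => h; rewrite ler_pdivrMr// mulrC; apply: h.
  pose B := rep @: Ad.
  have BP j : j \in B -> exists2 i, i \in Ad & j = rep i by move/imsetP.
  have Binj : {in B &, forall j j', j != j' -> m j != m j'}.
    move=> j j' /BP[i /AdP[iA _] ->] /BP[i' /AdP[iA' _] ->]; apply: contraNneq.
    have [_ ->] := repP i iA; have [_ ->] := repP i' iA'; by move=> e; apply/eqP; apply: rep_eq.
  have BD j : j \in B -> (D ^+ 2 %| 4 * m j)%Z.
    by move=> /BP[i iA ->]; have [iA1 _] := AdP i iA; have [_ ->] := repP i iA1; apply: D2m.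
  have BA j : j \in B -> j \in A1.
    by move=> /BP[i iA ->]; have [iA1 _] := AdP i iA; have [] := repP i iA1.
  have Bdiam : {in B &, forall j j', (m j)%:~R - (m j')%:~R <= 2 * M :> R}.
    move=> j j' /BA/A1A jA /BA/A1A j'A.
    have := mM j jA; have := mM j' j'A; rewrite !ler_norml; lra.
  have j0B : rep i0 \in B by apply: imset_f.
  have mj0 := mM _ (A1A _ (BA _ j0B)).
  have M1 : 1 <= M by apply: le_trans mj0; apply: m1; apply: BA.
  have DM : D%:~R ^+ 2 / 4 <= M.
    apply: le_trans mj0; apply: D2le; last exact: BD.
    by have := BA _ j0B; rewrite inE => /andP[].
  (* [B] has one element for each value of m. These values lie in [-M, M] and are spaced both by 1
     and by D^2/4. The bound 3 M pays for the term 1 of [fib]; the bound 12 M / D^2 pays for w D /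
     r, the product being 36 Q^3/(N D). *)
  have B1 : #|B|%:R <= 3 * M.
    have := @spaced_card R I B (fun j => (m j)%:~R) 1 (2 * M) ltr01.
    rewrite mulr_ge0// divr1 => /(_ isT _ Bdiam) h; apply: (le_trans (h _)); last by lra.
    move=> j j' jB j'B jj'; rewrite -intrB -intr_norm ler1z -gtz0_ge1 normr_gt0 subr_eq0.
    exact: Binj.
  have B2 : #|B|%:R <= 12 * M / D%:~R ^+ 2.
    have s0 : 0 < D%:~R ^+ 2 / 4 :> R by rewrite divr_gt0 ?exprn_gt0.
    have := @spaced_card R I B (fun j => (m j)%:~R) (D%:~R ^+ 2 / 4) (2 * M) s0.
    rewrite mulr_ge0// => /(_ isT _ Bdiam) h; apply: (le_trans (h _)).
      move=> j j' jB j'B jj'; rewrite -intrB; apply: D2le.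
        by rewrite subr_eq0; apply: Binj.
      by rewrite mulrBr rpredB ?BD.
    rewrite (_ : 2 * M / (D%:~R ^+ 2 / 4) = 8 * M / D%:~R ^+ 2); last by field; rewrite gt_eqF.
    rewrite (_ : 12 * M / D%:~R ^+ 2 = 4 * M / D%:~R ^+ 2 + 8 * M / D%:~R ^+ 2); last by field; rewrite gt_eqF.
    by rewrite lerD2r ler_pdivlMr ?exprn_gt0// mul1r; lra.
  pose w : R := 3 * Q%:R / N%:R / W.
  have w0 : 0 <= w by rewrite /w !mulr_ge0 ?invr_ge0// ltW.
  have fibP i j : i \in [set i in Ad | rep i == j] -> [/\ i \in A1, dd i = d & rep i = j].
    by rewrite inE => /andP[/AdP[? ?] /eqP].
  have fib j : j \in B -> #|[set i in Ad | rep i == j]|%:R <= 1 + w * D%:~R / r%:R.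
    move=> jB; have s0 : 0 < r%:R / D%:~R :> R by rewrite divr_gt0.
    have := @spaced_card R I [set i in Ad | rep i == j] (fun i => (q i)%:R) _ w s0 w0.
    rewrite (_ : w / (r%:R / D%:~R) = w * D%:~R / r%:R); last by field; rewrite !gt_eqF.
    apply.
      move=> i i' /fibP[iA1 di ri] /fibP[iA1' di' ri'] ii'.
      have [_ mi] := repP i iA1; have [_ mi'] := repP i' iA1'.
      have qq : (q i)%:Z != (q i')%:Z.
        apply: contraNneq ii' => -[e]; apply/eqP; apply: inj; rewrite ?A1A//.
        apply: (mulIf (lt0r_neq0 r0z)).
        by move: mi mi'; rewrite ri ri' => -> /eqP; rewrite /m e => /eqP /addIr.
      have h1 := sqr_dvd i iA1; have h2 := sqr_dvd i' iA1'.
      rewrite ri in h1; rewrite ri' in h2.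
      have e1 := ddz i; have e2 := ddz i'; rewrite di ri in e1; rewrite di' ri' in e2.
      have := sqr_class_spacing r0z h1 h2 (esym e1) (esym e2) qq.
      rewrite -/D -(ler_int R) intrM intr_norm intrB -!pmulrn.
      by rewrite ler_pdivrMr.
    move=> i i' /fibP[iA1 _ ri] /fibP[iA1' _ ri'].
    have [_ mi] := repP i iA1; have [_ mi'] := repP i' iA1'.
    by apply: diam; rewrite ?A1A// -mi -mi' ri ri'.
  have -> : #|Ad|%:R = \sum_(j in B) #|[set i in Ad | rep i == j]|%:R :> R.
    rewrite -natr_sum -sum1_card (partition_big rep (mem B))/=; last by move=> i iA; apply: imset_f.
    congr (_%:R); apply: eq_bigr => j _; rewrite -sum1_card.
    by apply: eq_bigl => i; rewrite !inE.
  apply: (@le_trans _ _ (\sum_(j in B) (1 + w * D%:~R / r%:R))); first by apply: ler_sum.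
  rewrite sumr_const -[leLHS]mulr_natl mulrDr mulr1 lerD//.
  apply: (@le_trans _ _ (12 * M / D%:~R ^+ 2 * (w * D%:~R / r%:R))).
    by rewrite ler_wpM2r// divr_ge0// mulr_ge0// ltW.
  rewrite [leLHS](_ : _ = (36 * (Q%:R ^+ 3 / N%:R)) / D%:~R); last first.
    rewrite /w /M; field; by rewrite !gt_eqF.
  rewrite ler_pdivrMr// ler_peMr// mulr_ge0// mulr_ge0 ?invr_ge0 ?exprn_ge0.
have A1E : (#|A1| = \sum_(d <- divisors r) #|[set i in A1 | dd i == d]|)%N.
  rewrite -sum1_card (eq_bigr (fun i => \sum_(d <- divisors r) (dd i == d : nat))%N); last first.
    move=> i iA1; rewrite (bigD1_seq (dd i)) ?divisors_uniq//=; last first.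
      by rewrite -dvdn_divisors// dvdn_gcdl.
    by rewrite eqxx big1 ?addn0// => d; rewrite eq_sym => /negPf ->.
  rewrite exchange_big /=; apply: eq_bigr => d _.
  rewrite -sum1_card [LHS]big_mkcond [RHS]big_mkcond; apply: eq_bigr => i _; rewrite !inE.
  by case: (i \in A); case: (m i == 0); case: (dd i == d).
rewrite A01 natrD lerD ?ler1n ?lern1//.
rewrite A1E natr_sum; apply: (@le_trans _ _ (\sum_(d <- divisors r) (3 * M + 36 * (Q%:R ^+ 3 / N%:R)))).
  by apply: ler_sum.
by rewrite big_const_seq count_predT iter_addr_0 [leRHS]mulr_natl.
Qed.

(** * Weyl differencing *)

(** The double sum for |sum e|^2 sorted by the difference h: the diagonal gives n, and h and -h are
    conjugate. For a quadratic phase the inner sums become linear in q. *)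
Lemma exp_sum_sqrE (R : realType) (th : nat -> R) (n : nat) :
  (\sum_(q < n) cos (th q)) ^+ 2 + (\sum_(q < n) sin (th q)) ^+ 2 =
  n%:R + 2 * \sum_(1 <= h < n) \sum_(q < n - h) cos (th (q + h)%N - th q).
Proof.
elim: n => [|n IHn]; first by rewrite !big_ord0 big_geq// expr0n mulr0 addr0.
rewrite !big_ord_recr /=.
set C := \sum_(q < n) cos _ in IHn *; set S := \sum_(q < n) sin _ in IHn *.
have -> : \sum_(1 <= h < n.+1) \sum_(q < n.+1 - h) cos (th (q + h)%N - th q) =
    \sum_(1 <= h < n) \sum_(q < n - h) cos (th (q + h)%N - th q) + \sum_(q < n) cos (th n - th q).
  transitivity (\sum_(1 <= h < n.+1) (\sum_(q < n - h) cos (th (q + h)%N - th q) + cos (th n - th (n - h)%N))).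
    apply: eq_big_nat => h /andP[h1 hn]; rewrite subSn// big_ord_recr /= subnK//.
  rewrite big_split /=; congr (_ + _).
    case: (n) => [|m]; first by rewrite !big_geq.
    by rewrite big_nat_recr//= subnn big_ord0 addr0.
  rewrite big_add1 /= big_nat_rev /= add0n -(big_mkord predT (fun q => cos (th n - th q))).
  by apply: eq_big_nat => h /andP[_ hn]; rewrite subnSK ?subKn// ltnW.
rewrite mulrDr addrA.
have -> : \sum_(q < n) cos (th n - th q) = cos (th n) * C + sin (th n) * S.
  by rewrite !mulr_sumr -big_split /=; apply: eq_bigr => q _; rewrite cosB.
by rewrite -[n.+1%:R]natr1; have := cos2Dsin2 (th n); lra.
Qed.

(** With truncated subtraction [s - t + (t - s)] is |s - t|, and a positive distance is attained by
    at most two t. *)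
Lemma sum_dist_le (R : realType) (L s : nat) (f : nat -> R) : (forall l, 0 <= f l) -> (s < L)%N ->
  \sum_(t < L) f (s - t + (t - s))%N <= f 0 + 2 * \sum_(1 <= l < L) f l.
Proof.
move=> f0 sL; rewrite -(big_mkord predT (fun t => f (s - t + (t - s))%N)) /=.
rewrite (big_cat_nat (leq0n s) (ltnW sL)) /= (big_ltn sL).
have -> : \sum_(0 <= t < s) f (s - t + (t - s))%N = \sum_(1 <= l < s.+1) f l.
  rewrite big_nat_rev big_add1 /= add0n; apply: eq_big_nat => t /andP[_ ts].
  by congr f; lia.
have -> : \sum_(s.+1 <= t < L) f (s - t + (t - s))%N = \sum_(1 <= l < L - s) f l.
  rewrite -(add1n s) big_addn; apply: eq_big_nat => t _; congr f; lia.
have mono m : (0 < m <= L)%N -> \sum_(1 <= l < m) f l <= \sum_(1 <= l < L) f l.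
  move=> /andP[m0 mL]; rewrite (big_cat_nat (n := m) (m := 1) (p := L) m0 mL) /= lerDl.
  by apply: sumr_ge0.
rewrite subnn addn0; have := mono s.+1; have := mono (L - s)%N.
by rewrite subn_gt0 sL leq_subr => /(_ isT) h1 /(_ isT) h2; lra.
Qed.

(** In k = 2 l h the divisor l of k determines h, so k has at most d(k) representations. The 2 comes
    from l ((q + h)^2 - q^2) = 2 l h q + l h^2. *)
Lemma sum_products_le (R : realType) (L n : nat) (G : nat -> R) (Dm : R) :
  (forall k, 0 <= G k) ->
  (forall k, (0 < k <= 2 * (L * n))%N -> (size (divisors k))%:R <= Dm) ->
  \sum_(1 <= l < L) \sum_(1 <= h < n) G (2 * (l * h))%N <=
  Dm * \sum_(k < 2 * (L * n)) G k.+1.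
Proof.
move=> G0 HD; set X := (2 * (L * n))%N.
have count (k : nat) : (0 < k <= X)%N ->
    (\sum_(1 <= l < L) \sum_(1 <= h < n) (2 * (l * h) == k))%:R <= Dm.
  move=> kX; apply: le_trans (HD k kX); rewrite ler_nat.
  have k0 : (0 < k)%N by case/andP: kX.
  apply: (@leq_trans (\sum_(1 <= l < L) (l %| k))).
    rewrite big_nat_cond [X in (_ <= X)%N]big_nat_cond; apply: leq_sum => l /andP[/andP[l1 _] _].
    have [lk|lk] := boolP (l %| k)%N; last first.
      rewrite big1// => h _; apply/eqP; rewrite eqb0; apply: contraNneq lk => <-.
      by rewrite dvdn_mull// dvdn_mulr.
    rewrite (eq_bigr (fun h => (2 * h == k %/ l)%N : nat)) => [|h _]; last first.
      congr (nat_of_bool _); rewrite -{1}(divnK lk) mulnCA [RHS]eq_sym mulnC.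
      by rewrite eqn_pmul2r// eq_sym.
    have [|] := boolP (has (fun h => 2 * h == k %/ l)%N (index_iota 1 n)); last first.
      by move=> /hasPn hn; rewrite big_seq big1// => h /hn /negPf ->.
    move=> /hasP[h0 h0n /eqP <-]; rewrite (bigD1_seq h0) ?iota_uniq//= eqxx.
    by rewrite big1// => h hh; rewrite eqn_pmul2l// (negPf hh).
  rewrite -(big_mkcond (fun l => l %| k)%N (fun=> 1%N)) /= sum1_count -size_filter.
  apply: uniq_leq_size; first by rewrite filter_uniq// iota_uniq.
  by move=> l; rewrite mem_filter -dvdn_divisors// => /andP[].
have -> : \sum_(1 <= l < L) \sum_(1 <= h < n) G (2 * (l * h))%N =
    \sum_(k < X) (\sum_(1 <= l < L) \sum_(1 <= h < n) (2 * (l * h) == k.+1))%:R * G k.+1.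
  transitivity (\sum_(1 <= l < L) \sum_(1 <= h < n) \sum_(k < X) (2 * (l * h) == k.+1)%N%:R * G k.+1).
    apply: eq_big_nat => l /andP[l1 lL]; apply: eq_big_nat => h /andP[h1 hn].
    have lhX : ((2 * (l * h)).-1 < X)%N by rewrite /X; nia.
    rewrite (bigD1 (Ordinal lhX)) //= prednK ?muln_gt0 ?l1 ?h1// eqxx mul1r big1 ?addr0// => k kn.
    case: eqP => [e|_]; last by rewrite mul0r.
    by move: kn; rewrite -val_eqE /= e eqxx.
  under eq_bigr => l _ do rewrite exchange_big.
  rewrite exchange_big /=; apply: eq_bigr => k _.
  rewrite natr_sum mulr_suml; apply: eq_bigr => l _.
  by rewrite natr_sum mulr_suml.
rewrite mulr_sumr; apply: ler_sum => k _; apply: ler_wpM2r => //.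
by apply: count; rewrite ltn_ord.
Qed.

(* [0^-1 = 0], so the zeros of the sine need their own case. *)
Definition recip_sin (R : realType) (n : nat) (x : R) : R :=
  if sin (pi * x) == 0 then n%:R else Num.min n%:R `|sin (pi * x)|^-1.

Lemma recip_sin_ge0 (R : realType) n (x : R) : 0 <= recip_sin n x.
Proof. by rewrite /recip_sin; case: eqP => // _; rewrite le_min invr_ge0 ler0n normr_ge0. Qed.

Lemma recip_sin_le (R : realType) n (x : R) : recip_sin n x <= n%:R.
Proof. by rewrite /recip_sin; case: eqP => // _; rewrite ge_min lexx. Qed.

Lemma recip_sin_far (R : realType) n (x c : R) : 0 < c -> c <= `|sin (pi * x)| ->
  recip_sin n x <= c^-1.
Proof.
move=> c0 cx; have s0 : 0 < `|sin (pi * x)| by apply: lt_le_trans cx.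
rewrite /recip_sin -normr_eq0 gt_eqF// ge_min lef_pV2 ?posrE// cx orbT//.
Qed.

Lemma cos_sum_recip (R : realType) (x phi : R) (n m : nat) : (m <= n)%N ->
  `|\sum_(k < m) cos (2 * pi * (k%:R * x) + phi)| <= recip_sin n x.
Proof.
move=> mn; have triv : `|\sum_(k < m) cos (2 * pi * (k%:R * x) + phi)| <= n%:R.
  apply: (le_trans (ler_norm_sum _ _ _)); apply: (@le_trans _ _ (\sum_(k < m) 1)).
    by apply: ler_sum => k _; apply: cos_max.
  by rewrite sumr_const card_ord ler_nat.
rewrite /recip_sin; case: eqP => [//|/eqP s0]; rewrite le_min triv /=.
by rewrite -[leRHS]mul1r ler_pdivlMr ?normr_gt0// cos_sum_le.
Qed.

(** Indices k whose multiples of x share a window of radius 1/(5r) mod 1 are r/2-spaced, so a window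
    holds at most 1 + 2X/r of them. [cell_sum] with 5r cells then leaves a harmonic sum. *)
Lemma sum_recip_sin (R : realType) (x Hm : R) (X n r : nat) (b : int) :
  (0 < r)%N -> coprimez b r -> `|r%:R * x - b%:~R| <= r%:R^-1 ->
  \sum_(1 <= d < 5 * r) d%:R^-1 <= Hm ->
  \sum_(k < X) recip_sin n (k.+1%:R * x) <=
  2 * (1 + 2 * X%:R / r%:R) * (n%:R + 5 * r%:R * Hm).
Proof.
move=> r0 br xb HH; have r0R : 0 < r%:R :> R by rewrite ltr0n.
have r5 : (0 < 5 * r)%N by rewrite muln_gt0.
have r5R : 0 < (5 * r)%:R :> R by rewrite ltr0n.
pose g (d : nat) : R := if d == 0%N then n%:R else (5 * r)%:R / d%:R.
have main : \sum_(k in [set: 'I_X]) recip_sin n (k.+1%:R * x) <=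
    2 * (1 + 2 * X%:R / r%:R) * \sum_(d < 5 * r) g d.
  apply: (cell_sum (y := fun k : 'I_X => k.+1%:R * x) r5).
  - by move=> d; rewrite /g; case: eqP => _ //; rewrite divr_ge0.
  - move=> y.
    have s0 : 0 < r%:R / 2 :> R by rewrite divr_gt0.
    rewrite (_ : 2 * X%:R / r%:R = X%:R / (r%:R / 2)); last by field; rewrite gt_eqF.
    apply: (spaced_card (f := fun k : 'I_X => k%:R) s0) => //; last first.
      move=> k k' _ _; have := ler0n R k'; have : k%:R <= X%:R :> R by rewrite ler_nat ltnW.
      by lra.
    move=> k k'; rewrite !inE /= => -[t ht] [t' ht'] kk'.
    rewrite leNgt; apply/negP => hlt.
    pose h : int := k%:Z - k'%:Z.
    have h0 : h != 0 by rewrite subr_eq0; apply: contra kk' => /eqP[/val_inj ->].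
    have hR : h%:~R = k%:R - k'%:R :> R by rewrite /h intrB.
    (* If |h| < r/2, this integer is nonzero, as r would otherwise divide h. Yet |w| <= 2/5 + 1/2 <
       1: the windows give 2/5, the approximation of x gives 1/2, and this is why the cells have
       length 1/(5r). *)
    pose w : int := h * b + (t - t') * r%:Z.
    have w0 : w != 0.
      apply/eqP => w0; have : (r%:Z %| h * b)%Z.
        by apply/dvdzP; exists (t' - t); move: w0; rewrite /w; lia.
      rewrite Gauss_dvdzl; last by rewrite /coprimez gcdzC.
      rewrite dvdzE => /dvdn_leq; rewrite absz_gt0 => /(_ h0).
      rewrite -(ler_nat R) /= => hr; move: hlt; rewrite -hR.
      have : `|h%:~R| = `|h|%:R :> R by rewrite -intr_norm -abszE.
      by move=> ->; move: hr r0R; move: (`|h|%:R) (r%:R) => *; lra.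
    have w1 : 1 <= `|w%:~R| :> R by rewrite -intr_norm ler1z -gtz0_ge1 normr_gt0.
    have wE : w%:~R = r%:R * ((k.+1%:R * x + t%:~R - y) - (k'.+1%:R * x + t'%:~R - y))
        - h%:~R * (r%:R * x - b%:~R) :> R.
      by rewrite hR /w intrD !intrM intrB hR -[k.+1%:R]natr1 -[k'.+1%:R]natr1 -pmulrn; ring.
    have e1 : `|r%:R * ((k.+1%:R * x + t%:~R - y) - (k'.+1%:R * x + t'%:~R - y))| <= 2 / 5 :> R.
      rewrite normrM normr_nat (_ : 2 / 5 = r%:R * (2 * (5 * r)%:R^-1)); last first.
        by rewrite natrM; field; rewrite gt_eqF.
      rewrite ler_pM2l//; apply: (le_trans (ler_normB _ _)).
      by move: ht ht'; move: ((5 * r)%:R^-1) => v; lra.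
    have e2 : `|h%:~R * (r%:R * x - b%:~R)| <= 1 / 2 :> R.
      rewrite normrM hR (_ : 1 / 2 = (r%:R / 2) * r%:R^-1); last by field; rewrite gt_eqF.
      by rewrite ler_pM// ltW.
    move: w1; rewrite wE => w1; have := le_trans w1 (ler_normB _ _); lra.
  - move=> k d _ far; rewrite /g; case: eqP => [_|/eqP d0]; first exact: recip_sin_le.
    rewrite -invf_div; apply: recip_sin_far; last exact: sin_pi_far.
    by rewrite divr_gt0// ltr0n lt0n.
have setTE : \sum_(k in [set: 'I_X]) recip_sin n (k.+1%:R * x) = \sum_(k < X) recip_sin n (k.+1%:R * x).
  by apply: eq_bigl => k; rewrite inE.
rewrite setTE in main; apply: (le_trans main).
apply: ler_wpM2l; first by rewrite mulr_ge0// addr_ge0// divr_ge0// mulr_ge0.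
rewrite -(big_mkord predT g) big_ltn//= {1}/g eqxx lerD2l.
rewrite (eq_big_nat _ _ (F2 := fun d => (5 * r)%:R * d%:R^-1)); last first.
  by move=> d /andP[d1 _]; rewrite /g eqn0Ngt d1.
by rewrite -mulr_sumr natrM ler_wpM2l ?mulr_ge0.
Qed.

Lemma sqr_sum_le_nat (R : realType) (V : nat -> R) (L : nat) :
  (\sum_(1 <= l < L) V l) ^+ 2 <= L%:R * \sum_(1 <= l < L) V l ^+ 2.
Proof.
set S := \sum_(1 <= l < L) V l ^+ 2.
have S0 : 0 <= S by apply: sumr_ge0 => l _; apply: sqr_ge0.
rewrite expr2 big_distrlr /=.
apply: (@le_trans _ _ (\sum_(1 <= i < L) \sum_(1 <= j < L) (2^-1 * V i ^+ 2 + 2^-1 * V j ^+ 2))).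
  by apply: ler_sum => i _; apply: ler_sum => j _; have := sqr_ge0 (V i - V j); rewrite sqrrB; lra.
under eq_bigr => i _ do rewrite big_split /= sumr_const_nat -mulr_sumr -/S -mulr_natl.
rewrite big_split /= -!mulr_sumr -/S sumr_const_nat -[_ *+ (L - 1)]mulr_natl.
have : (L - 1)%:R <= L%:R :> R by rewrite ler_nat leq_subr.
rewrite sumrMnl -mulr_sumr -/S -[_ *+ (L - 1)]mulr_natl => /(ler_wpM2r S0); lra.
Qed.

(** Each counted q has kernel value at least L^2/4, while the sum of the kernel over all q < n is at
    most L (n + 2Y), with Y a sum of quadratic cosine sums. Cauchy-Schwarz over l and one
    differencing step reduce Y^2 to reciprocal sines. *)
Lemma weyl_count (R : realType) (x Dm Hm : R) (n L r : nat) (b : int) :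
  (0 < n)%N -> (0 < L)%N -> (n <= r)%N -> coprimez b r -> `|r%:R * x - b%:~R| <= r%:R^-1 ->
  1 <= Dm -> 1 <= Hm ->
  (forall k, (0 < k <= 2 * (L * n))%N -> (size (divisors k))%:R <= Dm) ->
  \sum_(1 <= d < 5 * r) d%:R^-1 <= Hm ->
  #|[set q : 'I_n | `[< exists t : int, `|q%:R ^+ 2 * x + t%:~R| * (6 * L%:R) <= 1 >]]|%:R
  <= 4 * n%:R / L%:R + 8 * Num.sqrt (Dm * Hm * (101 * n%:R + 20 * (r%:R / L%:R))).
Proof.
move=> n0 L0 nr br xb D1 H1 HD HH; set A := [set q : 'I_n | _].
have r0 : (0 < r)%N by apply: leq_trans nr.
have L0R : 0 < L%:R :> R by rewrite ltr0n.
have r0R : 0 < r%:R :> R by rewrite ltr0n.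
pose V (l : nat) : R := `|\sum_(q < n) cos (2 * pi * (l%:R * (q%:R ^+ 2 * x)))|.
have V0 l : 0 <= V l by rewrite /V.
pose Y := \sum_(1 <= l < L) V l.
have step1 : L%:R ^+ 2 / 4 * #|A|%:R <= L%:R * (n%:R + 2 * Y).
  apply: (@le_trans _ _ (\sum_(q in A) dirichlet_kernel L (q%:R ^+ 2 * x))).
    rewrite mulr_natr -sumr_const; apply: ler_sum => q.
    rewrite !inE /= => -[t ht]; exact: dirichlet_kernel_near ht.
  apply: (@le_trans _ _ (\sum_(q < n) dirichlet_kernel L (q%:R ^+ 2 * x))).
    rewrite [leRHS](bigID (fun q => q \in A)) /= lerDl.
    by apply: sumr_ge0 => q _; apply: dirichlet_kernel_ge0.
  under eq_bigr => q _ do rewrite -dirichlet_kernelE.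
  rewrite exchange_big /=; under eq_bigr => s _ do rewrite exchange_big /=.
  have -> : L%:R * (n%:R + 2 * Y) = \sum_(s < L) (n%:R + 2 * Y) by rewrite sumr_const card_ord mulr_natl.
  apply: ler_sum => s _.
  apply: (@le_trans _ _ (\sum_(t < L) V (s - t + (t - s))%N)).
    apply: ler_sum => t _; apply: (le_trans (ler_norm _)).
    rewrite /V le_eqVlt; apply/orP; left; apply/eqP; congr `|_|.
    apply: eq_bigr => q _; have [ts|st] := leqP t s.
      by rewrite (eqP ts) addn0 natrB.
    rewrite (_ : (s - t = 0)%N); last by apply/eqP; rewrite subn_eq0 ltnW.
    rewrite add0n natrB ?(ltnW st)// -cosN -mulrN -mulNr opprB//.
  apply: (le_trans (sum_dist_le V0 (ltn_ord s))).
  rewrite lerD2r /V (eq_bigr (fun=> 1)); last by move=> q _; rewrite mul0r mulr0 cos0.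
  by rewrite sumr_const card_ord normr_nat.
have E l : V l ^+ 2 <= n%:R + 2 * \sum_(1 <= h < n) recip_sin n ((2 * (l * h))%:R * x).
  rewrite /V real_normK ?num_real//.
  apply: (@le_trans _ _ ((\sum_(q < n) cos (2 * pi * (l%:R * (q%:R ^+ 2 * x)))) ^+ 2
     + (\sum_(q < n) sin (2 * pi * (l%:R * (q%:R ^+ 2 * x)))) ^+ 2)); first by rewrite lerDl sqr_ge0.
  rewrite (exp_sum_sqrE (fun q => 2 * pi * (l%:R * (q%:R ^+ 2 * x)))) lerD2l ler_pM2l//.
  apply: ler_sum => h _; apply: (le_trans (ler_norm _)).
  rewrite (eq_bigr (fun q : 'I_(n - h) => cos (2 * pi * (q%:R * ((2 * (l * h))%:R * x))
      + 2 * pi * (l%:R * (h%:R ^+ 2 * x))))); last first.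
    by move=> q _; congr cos; rewrite natrD !natrM; ring.
  by apply: cos_sum_recip; rewrite leq_subr.
pose T := \sum_(k < 2 * (L * n)) recip_sin n (k.+1%:R * x).
have T0 : 0 <= T by apply: sumr_ge0 => k _; apply: recip_sin_ge0.
have step2 : Y ^+ 2 <= L%:R * (L%:R * n%:R + 2 * (Dm * T)).
  have cs : Y ^+ 2 <= L%:R * \sum_(1 <= l < L) V l ^+ 2.
    exact: sqr_sum_le_nat.
  apply: (le_trans cs); rewrite ler_pM2l//.
  apply: (@le_trans _ _ (\sum_(1 <= l < L) (n%:R + 2 * \sum_(1 <= h < n) recip_sin n ((2 * (l * h))%:R * x)))).
    by apply: ler_sum.
  rewrite big_split /= lerD//.
    by rewrite sumr_const_nat -mulrnA -natrM ler_nat mulnC leq_mul// leq_subr.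
  rewrite -mulr_sumr ler_pM2l//.
  exact: (sum_products_le (fun k => recip_sin_ge0 n (k%:R * x)) HD).
have TT : T <= 2 * (1 + 2 * (2 * (L * n))%:R / r%:R) * (n%:R + 5 * r%:R * Hm).
  exact: sum_recip_sin xb HH.
set B := Dm * Hm * (101 * n%:R + 20 * (r%:R / L%:R)).
have DH1 : 1 <= Dm * Hm by rewrite -(mulr1 1) ler_pM.
have B0 : 0 <= B by rewrite mulr_ge0 ?(le_trans ler01 DH1)// addr_ge0// mulr_ge0// divr_ge0.
have YB : Y <= L%:R * Num.sqrt B.
  have Y0 : 0 <= Y by apply: sumr_ge0 => l _.
  rewrite -(@ler_pXn2r _ 2) ?nnegrE ?mulr_ge0 ?sqrtr_ge0// exprMn sqr_sqrtr//.
  apply: (le_trans step2).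
  have nrR : n%:R <= r%:R :> R by rewrite ler_nat.
  have nR0 : 0 <= n%:R :> R by [].
  (* The hypothesis n <= r absorbs the term L n^2/r into L n. Then L n + 2 Dm T yields 101 = 1 + 4 *
     25 and 20 = 4 * 5. *)
  have TT2 : T <= 2 * Hm * (25 * (L%:R * n%:R) + 5 * r%:R).
    apply: (le_trans TT); rewrite !natrM.
    rewrite (_ : 2 * (1 + 2 * (2 * (L%:R * n%:R)) / r%:R) * (n%:R + 5 * r%:R * Hm) =
      2 * n%:R + 10 * r%:R * Hm + 8 * L%:R * n%:R * (n%:R / r%:R) + 40 * (L%:R * n%:R * Hm)); last first.
      by field; rewrite gt_eqF.
    have nr1 : n%:R / r%:R <= 1 :> R by rewrite ler_pdivrMr// mul1r.
    have h1 : 8 * L%:R * n%:R * (n%:R / r%:R) <= 8 * L%:R * n%:R * 1 :> R.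
      by rewrite ler_wpM2l// !mulr_ge0.
    have L1 : 1 <= L%:R :> R by rewrite ler1n.
    have h2 : n%:R <= L%:R * n%:R :> R by rewrite ler_peMl.
    have h3 : L%:R * n%:R <= L%:R * n%:R * Hm by rewrite ler_peMr// mulr_ge0.
    lra.
  have h4 : Dm * T <= Dm * (2 * Hm * (25 * (L%:R * n%:R) + 5 * r%:R)).
    by rewrite ler_wpM2l// (le_trans ler01).
  have h5 : L%:R * n%:R <= Dm * Hm * (L%:R * n%:R) by rewrite ler_peMl// mulr_ge0.
  rewrite (_ : L%:R ^+ 2 * B = L%:R * (Dm * Hm * (L%:R * n%:R) + 2 * (Dm * (2 * Hm * (25 * (L%:R * n%:R) + 5 * r%:R))))); last first.
    by rewrite /B; field; rewrite gt_eqF.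
  by rewrite ler_pM2l//; lra.
have LL : 0 < L%:R ^+ 2 / 4 :> R by rewrite divr_gt0 ?exprn_gt0.
rewrite -(ler_pM2l LL); apply: (le_trans step1).
rewrite (_ : L%:R ^+ 2 / 4 * _ = L%:R * (n%:R + 2 * (L%:R * Num.sqrt B))); last by field; rewrite gt_eqF.
by rewrite ler_pM2l// lerD2l ler_pM2l.
Qed.

(** * Counting Farey fractions with square denominators *)

Lemma intr_far (R : realType) (m n : int) : m != n -> 1 <= `|m%:~R - n%:~R| :> R.
Proof. by move=> mn; rewrite -intrB -intr_norm ler1z -gtz0_ge1 normr_gt0 subr_eq0. Qed.

(** Dirichlet's parameter must be an integer; rounding it down costs a factor 2. *)
Lemma truncn_half (R : realType) (x : R) : 1 <= x ->
  [/\ (0 < Num.truncn x)%N, (Num.truncn x)%:R <= x & (Num.truncn x)%:R^-1 <= 2 / x].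
Proof.
move=> x1; have x0 : 0 <= x by apply: le_trans x1.
have t0 : (0 < Num.truncn x)%N by rewrite truncn_gt0.
split => //; first by rewrite truncn_le.
have /andP[_ h] := truncn_itv x0; rewrite -[(_).+1%:R]natr1 in h.
have t1 : 1 <= (Num.truncn x)%:R :> R by rewrite ler1n.
rewrite ler_pdivlMr ?(lt_le_trans ltr01)// -ler_pdivlMl ?invr_gt0 ?ltr0n// invrK.
lra.
Qed.

(* [D], [H] stand for the divisor and harmonic sum bounds, [K] for their product,
   [c] for [Q ^ 3 / N] and [u] for [Q ^ 2 / sqrt N] or [sqrt Q]. *)
Lemma absorb_const (R : realType) (X K c u : R) :
  1 <= K -> 0 <= c -> 0 <= u -> X <= 250 * (c + u) -> X <= 250 * K * (1 + c + u).
Proof.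
move=> K1 c0 u0 hX; apply: (le_trans hX); rewrite -mulrA ler_pM2l//.
have s0 : 0 <= 1 + c + u by lra.
by apply: le_trans (_ : 1 + c + u <= _); [lra | rewrite ler_peMl].
Qed.

(** The Weyl range is the most expensive one: 96 + 128 = 224 accounts for the common constant
    250. *)
Lemma absorb_weyl (R : realType) (K c u : R) :
  1 <= K -> 0 <= c -> 0 <= u -> 96 * c + 128 * (K * (c + u)) <= 250 * K * (1 + c + u).
Proof.
move=> K1 c0 u0; have K0 : 0 <= K by lra.
have := mulr_ge0 K0 u0; have : c <= K * c by rewrite ler_peMl.
by lra.
Qed.

Lemma absorb_divisors (R : realType) (D H E1 E2 c u : R) :
  1 <= D -> 1 <= H -> 0 <= c -> 0 <= u -> E1 <= 2 * u -> E2 <= c + u ->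
  1 + D * (3 * (E1 + E2) + 36 * c) <= 250 * (D * H) * (1 + c + u).
Proof.
move=> D1 H1 c0 u0 h3 h4; have D0 : 0 <= D by lra.
have s0 : 0 <= 1 + c + u by lra.
have h1 : D * (3 * (E1 + E2) + 36 * c) <= D * (50 * (c + u)) by apply: ler_wpM2l => //; lra.
have h2 : D * (1 + c + u) <= D * H * (1 + c + u) by rewrite ler_wpM2r// ler_peMr.
have := mulr_ge0 D0 c0; have := mulr_ge0 D0 u0; lra.
Qed.

Section NearCount.
Variables (R : realType) (I : finType) (A : {set I}) (q : I -> nat) (a : I -> int).
Variables (Q N : nat) (y : R).
Hypotheses (Q0 : (0 < Q)%N) (N0 : (0 < N)%N).
Hypothesis inj : {in A &, forall i j, q i = q j -> a i = a j -> i = j}.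
Hypothesis qQ : {in A, forall i, (0 < q i <= Q)%N}.
Hypothesis cop : {in A, forall i, coprimez (a i) (q i)}.
Hypothesis near : {in A, forall i, `|(a i)%:~R - y * (q i)%:R ^+ 2| <= (q i)%:R ^+ 2 / N%:R}.

Let N0R : 0 < N%:R :> R. Proof. by rewrite ltr0n. Qed.
Let Q1R : 1 <= Q%:R :> R. Proof. by rewrite ler1n. Qed.

Let QN_le : (Q * N <= (Q * N) ^ 2)%N.
Proof. by rewrite -mulnn leq_pmull// muln_gt0 Q0. Qed.

Let near_diam i j : i \in A -> j \in A -> q i = q j ->
  (a i)%:~R - (a j)%:~R <= 2 * Q%:R ^+ 2 / N%:R :> R.
Proof.
move=> iA jA qij; have := near iA; have := near jA; rewrite -qij.
have : (q i)%:R ^+ 2 / N%:R <= Q%:R ^+ 2 / N%:R :> R.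
  rewrite ler_pM2r ?invr_gt0// lerXn2r ?nnegrE// ler_nat.
  by have /andP[] := qQ iA.
by rewrite !ler_norml; lra.
Qed.

(** For fixed q the a are distinct integers in a window of length at most 2 Q^2/N. *)
Lemma near_count_trivial : #|A|%:R <= Q%:R + 2 * (Q%:R ^+ 3 / N%:R) :> R.
Proof.
have -> : #|A|%:R = \sum_(k < Q) #|[set i in A | q i == k.+1]|%:R :> R.
  pose p i : 'I_Q.+1 := inord (q i).
  have -> : #|A| = (\sum_(k < Q) #|[set i in A | q i == k.+1]|)%N; last by rewrite natr_sum.
  rewrite -sum1_card (partition_big p predT)//= big_ord_recl /= big1 ?add0n; last first.
    move=> i /andP[iA]; have /andP[h1 h2] := qQ iA.
    by rewrite -val_eqE /= inordK// gtn_eqF.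
  apply: eq_bigr => k _; rewrite -sum1_card; apply: eq_bigl => i; rewrite !inE.
  case iA : (i \in A) => //=; have /andP[h1 h2] := qQ iA.
  by rewrite -val_eqE /= inordK.
apply: (@le_trans _ _ (\sum_(k < Q) (1 + 2 * Q%:R ^+ 2 / N%:R))); last first.
  by rewrite sumr_const card_ord -[leLHS]mulr_natl le_eqVlt; apply/orP; left; apply/eqP; field; rewrite gt_eqF.
apply: ler_sum => k _; rewrite -[2 * _ / _]divr1.
apply: (spaced_card (f := fun i => (a i)%:~R)) => //.
- move=> i j; rewrite !inE => /andP[iA /eqP qi] /andP[jA /eqP qj] ij.
  by apply: intr_far; apply: contra_neq ij => aij; apply: inj => //; rewrite qi.
- move=> i j; rewrite !inE => /andP[iA /eqP qi] /andP[jA /eqP qj].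
  by apply: near_diam => //; rewrite qi.
Qed.

Variables (Dm Hm : R).
Hypotheses (D1 : 1 <= Dm) (H1 : 1 <= Hm).
(** One range covers all uses: moduli r up to N or Q^2, products 2 l h up to 4 Q N, and harmonic
    sums up to 5r. *)
Hypothesis HD : forall k, (0 < k <= 5 * (Q * N) ^ 2)%N -> (size (divisors k))%:R <= Dm.
Hypothesis HH : \sum_(1 <= d < (5 * (Q * N) ^ 2).+1) d%:R^-1 <= Hm.

Let rational_near_count r (b : int) : (0 < r <= 5 * (Q * N) ^ 2)%N -> coprimez b r ->
  #|A|%:R <= 1 + Dm * (3 * (Q%:R ^+ 2 * `|r%:R * y - b%:~R| + r%:R * Q%:R ^+ 2 / N%:R)
     + 36 * (Q%:R ^+ 3 / N%:R)).
Proof.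
move=> rP br; have r0 : (0 < r)%N by case/andP: rP.
have r0R : 0 < r%:R :> R by rewrite ltr0n.
pose z := y - b%:~R / r%:R.
have nr : {in A, forall i, `|(a i)%:~R - (b%:~R / r%:R + z) * (q i)%:R ^+ 2| <= (q i)%:R ^+ 2 / N%:R}.
  by move=> i iA; rewrite /z (addrC (b%:~R / _)) subrK; apply: near.
have := rational_count N0 r0 br inj qQ cop nr => h; apply: (le_trans h); rewrite lerD2l.
have -> : `|r%:R * y - b%:~R| = r%:R * `|z|.
  by rewrite -{2}(normr_nat R r) -normrM /z; congr `|_|; field; rewrite gt_eqF.
have X0 : 0 <= 3 * (r%:R * Q%:R ^+ 2 * (`|z| + N%:R^-1)) + 36 * (Q%:R ^+ 3 / N%:R).
  by rewrite addr_ge0// !mulr_ge0 ?exprn_ge0 ?addr_ge0 ?invr_ge0.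
apply: (le_trans (ler_wpM2r X0 (HD rP))).
by rewrite ler_pM2l ?(lt_le_trans ltr01)//; lra.
Qed.

(** Dirichlet's parameter sqrt N balances the two error terms: r |z| Q^2 and r Q^2/N are both <<
    Q^2/sqrt N. *)
Lemma near_count_sqrtN :
  #|A|%:R <= 250 * (Dm * Hm) * (1 + Q%:R ^+ 3 / N%:R + Q%:R ^+ 2 / Num.sqrt N%:R).
Proof.
have N1 : 1 <= N%:R :> R by rewrite ler1n.
set s : R := Num.sqrt N%:R; have s1 : 1 <= s by rewrite -[leLHS]sqrtr1 ler_wsqrtr.
have s0 : 0 < s by apply: lt_le_trans s1.
have ss : s ^+ 2 = N%:R by rewrite sqr_sqrtr.
have [t0 ts tV] := truncn_half s1.
have [r [b [/andP[r0 rt] br rb]]] := dirichlet_approx y t0.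
have rs : r%:R <= s by apply: le_trans ts; rewrite ler_nat.
have rP : (0 < r <= 5 * (Q * N) ^ 2)%N.
  rewrite r0 /=; apply: (@leq_trans N); last first.
    by rewrite (leq_trans (leq_pmull N Q0))// (leq_trans QN_le)// leq_pmull.
  rewrite -(ler_nat R); apply: (le_trans rs).
  by rewrite -ss expr2 ler_peMl// ltW.
apply: (le_trans (rational_near_count rP br)).
set c : R := Q%:R ^+ 3 / N%:R; have c0 : 0 <= c by rewrite divr_ge0// exprn_ge0.
set u : R := Q%:R ^+ 2 / s; have u0 : 0 <= u by rewrite divr_ge0 ?exprn_ge0 ?(ltW s0).
have e1 : Q%:R ^+ 2 * `|r%:R * y - b%:~R| <= 2 * u.
  apply: (@le_trans _ _ (Q%:R ^+ 2 * (2 / s))); last by rewrite /u; lra.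
  by rewrite ler_wpM2l ?sqr_ge0// (le_trans rb).
have e2 : r%:R * Q%:R ^+ 2 / N%:R <= u.
  rewrite -ss (_ : u = s * Q%:R ^+ 2 / s ^+ 2); last by rewrite /u; field; rewrite gt_eqF.
  by rewrite ler_pM2r ?invr_gt0 ?exprn_gt0// ler_wpM2r ?sqr_ge0.
by apply: absorb_divisors => //; rewrite (le_trans e2)// lerDr.
Qed.

Lemma near_count_sqrtQ :
  #|A|%:R <= 250 * (Dm * Hm) * (1 + Q%:R ^+ 3 / N%:R + Num.sqrt Q%:R).
Proof.
set s : R := Num.sqrt Q%:R; have s1 : 1 <= s by rewrite -[leLHS]sqrtr1 ler_wsqrtr.
have s0 : 0 < s by apply: lt_le_trans s1.
have ss : s ^+ 2 = Q%:R by rewrite sqr_sqrtr.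
have Qs1 : 1 <= Q%:R * s := mulr_ege1 Q1R s1.
have [t0 ts tV] := truncn_half Qs1.
have [r [b [/andP[r0 rt] br rb]]] := dirichlet_approx y t0.
have rs : r%:R <= Q%:R * s by apply: le_trans ts; rewrite ler_nat.
have sQ : s <= Q%:R by rewrite -ss expr2 ler_peMl// ltW.
have rQ2 : (r <= Q ^ 2)%N.
  by rewrite -(ler_nat R) natrX expr2; apply: (le_trans rs); rewrite ler_pM2l// (lt_le_trans ltr01).
have rP : (r <= 5 * (Q * N) ^ 2)%N by apply: (leq_trans rQ2); rewrite expnMn mulnCA leq_pmulr// muln_gt0 expn_gt0 N0.
set c : R := Q%:R ^+ 3 / N%:R; have c0 : 0 <= c by rewrite divr_ge0// exprn_ge0.
have h4 : 1 <= Dm * Hm by rewrite -(mulr1 1) ler_pM.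
have D0 : 0 <= Dm by apply: le_trans D1.
have cH : c <= Dm * Hm * c by rewrite ler_peMl.
have sH : s <= Dm * Hm * s by rewrite ler_peMl// ltW.
have [rQ|Qr] := leqP r Q.
  have rP' : (0 < r <= 5 * (Q * N) ^ 2)%N by rewrite r0.
  apply: (le_trans (rational_near_count rP' br)).
  have e1 : Q%:R ^+ 2 * `|r%:R * y - b%:~R| <= 2 * s.
    apply: (@le_trans _ _ (Q%:R ^+ 2 * (2 / (Q%:R * s)))).
      by rewrite ler_wpM2l ?sqr_ge0// (le_trans rb).
    rewrite -ss le_eqVlt; apply/orP; left; apply/eqP; field; rewrite gt_eqF//.
  have e2 : r%:R * Q%:R ^+ 2 / N%:R <= c.
    rewrite /c ler_pM2r ?invr_gt0// [leRHS]exprS ler_wpM2r ?sqr_ge0// ler_nat//.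
  by apply: absorb_divisors => //; [exact: ltW | rewrite (le_trans e2)// lerDl ltW].
(* Below 6 Q^2 the length [L] would be 0, but there Q <= 6 Q^3/N and the trivial count suffices. *)
have [NQ|QN] := ltnP N (6 * Q ^ 2).
  apply: (le_trans near_count_trivial).
  have : Q%:R <= 6 * c.
    rewrite /c mulrA ler_pdivlMr// exprS mulrCA ler_pM2l ?(lt_le_trans ltr01)//.
    by rewrite -natrX -natrM ler_nat ltnW.
  by move=> hc; rewrite -/c; apply: absorb_const => //; [exact: ltW | lra].
have Q2 : (0 < 6 * Q ^ 2)%N by rewrite muln_gt0 expn_gt0 Q0.
(* The largest length for which a distance Q^2/N to the integers lies within the window 1/(6L) of
   [weyl_count]. *)
pose L := (N %/ (6 * Q ^ 2))%N.
have L0 : (0 < L)%N by rewrite divn_gt0.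
have L0R : 0 < L%:R :> R by rewrite ltr0n.
have LN : (L * (6 * Q ^ 2) <= N)%N by apply: leq_divM.
have NL : (N <= 12 * Q ^ 2 * L)%N.
  have := ltn_ceil N Q2; rewrite -/L => h; apply: (leq_trans (ltnW h)).
  rewrite (_ : 12 * Q ^ 2 * L = L * (6 * Q ^ 2) + L * (6 * Q ^ 2))%N; last first.
    by rewrite mulnC -mulnDr -mulnDl.
  by rewrite mulSn leq_add2r leq_pmull.
have LV : L%:R^-1 <= 12 * Q%:R ^+ 2 / N%:R :> R.
  rewrite ler_pdivlMr// mulrC ler_pdivrMr// -natrX -!natrM ler_nat//.
have rb' : `|r%:R * y - b%:~R| <= r%:R^-1.
  by apply: (le_trans rb); rewrite lef_pV2 ?posrE ?ltr0n// ler_nat.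
have Q1L : (2 * (L * Q.+1) <= 5 * (Q * N) ^ 2)%N.
  have hLN : (L <= N)%N by apply: leq_trans LN; rewrite leq_pmulr.
  rewrite (@leq_trans (2 * (N * (2 * Q))))//.
    by rewrite leq_mul2l leq_mul// -addn1 mul2n -addnn leq_add2l.
  rewrite (_ : 2 * (N * (2 * Q)) = 4 * (Q * N))%N; last by ring.
  by rewrite leq_mul.
have HD' k : (0 < k <= 2 * (L * Q.+1))%N -> (size (divisors k))%:R <= Dm.
  by move=> /andP[k0 k1]; apply: HD; rewrite k0 (leq_trans k1).
have HH' : \sum_(1 <= d < 5 * r) d%:R^-1 <= Hm.
  apply: le_trans HH.
  rewrite [leRHS](big_cat_nat (n := 5 * r)%N) /=; last 2 first.
  - by rewrite muln_gt0.
  - by rewrite leqW// leq_mul2l (leq_trans rQ2)// expnMn leq_pmulr// expn_gt0 N0.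
  by rewrite lerDl sumr_ge0.
have := weyl_count (ltn0Sn Q) L0 Qr br rb' D1 H1 HD' HH'.
set W := [set k : 'I_Q.+1 | _] => Wle.
(* As 2 Q^2/N <= 1/3, each q carries at most one a, and it is enough to count the q. *)
have AW : (#|A| <= #|W|)%N.
  pose p i : 'I_Q.+1 := inord (q i).
  have pE i : i \in A -> p i = q i :> nat.
    by move=> iA; rewrite inordK// ltnS; have /andP[] := qQ iA.
  have pinj : {in A &, injective p}.
    move=> i j iA jA /(congr1 val); rewrite /= !pE// => qij.
    apply: inj => //; apply/eqP; apply: contraT => /(@intr_far R).
    have h : 2 * Q%:R ^+ 2 / N%:R <= 1 / 3 :> R.
      rewrite ler_pdivrMr//.
      have : (6 * Q ^ 2)%:R <= N%:R :> R by rewrite ler_nat.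
      by rewrite natrM natrX; lra.
    have h1 := near_diam iA jA qij; have h2 := near_diam jA iA (esym qij).
    by rewrite ler_normr; lra.
  rewrite -(card_in_imset pinj); apply: subset_leq_card.
  apply/fintype.subsetP => _ /imsetP[i iA ->]; rewrite !inE pE//=.
  exists (- a i); rewrite mulrNz -normrN opprB [_ * y]mulrC.
  have /andP[_ qi] := qQ iA.
  have qQR : (q i)%:R ^+ 2 <= Q%:R ^+ 2 :> R by rewrite lerXn2r ?nnegrE// ler_nat.
  apply: (@le_trans _ _ (Q%:R ^+ 2 / N%:R * (6 * L%:R))).
    rewrite ler_wpM2r ?mulr_ge0//; apply: (le_trans (near iA)).
    by rewrite ler_pM2r ?invr_gt0.
  rewrite mulrAC ler_pdivrMr// mul1r -natrX -!natrM ler_nat.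
  by apply: leq_trans LN; rewrite (_ : Q ^ 2 * (6 * L) = L * (6 * Q ^ 2))%N //; ring.
apply: (@le_trans _ _ #|W|%:R); first by rewrite ler_nat.
apply: (le_trans Wle).
have t1 : 4 * Q.+1%:R / L%:R <= 96 * c.
  apply: (@le_trans _ _ (4 * (2 * Q%:R) * (12 * Q%:R ^+ 2 / N%:R))).
    rewrite ler_pM// ?invr_ge0//.
    by rewrite ler_pM2l// -[Q.+1%:R]natr1; lra.
  by rewrite /c le_eqVlt; apply/orP; left; apply/eqP; field; rewrite gt_eqF.
(* Here Q = s^2 and r/L <= 12 s c: the mixed term fits into the square of s + c. *)
have t2 : 101 * Q.+1%:R + 20 * (r%:R / L%:R) <= (16 * (s + c)) ^+ 2.
  apply: (@le_trans _ _ (202 * s ^+ 2 + 240 * (s * c))).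
    apply: lerD; first by rewrite ss -[Q.+1%:R]natr1; lra.
    have : r%:R / L%:R <= (Q%:R * s) * (12 * Q%:R ^+ 2 / N%:R) by rewrite ler_pM// invr_ge0.
    have -> : (Q%:R * s) * (12 * Q%:R ^+ 2 / N%:R) = 12 * (s * c) by rewrite /c; field; rewrite gt_eqF.
    by lra.
  rewrite exprMn sqrrD; have := mulr_ge0 (ltW s0) c0; have := sqr_ge0 s; have := sqr_ge0 c; lra.
have t3 : Num.sqrt (Dm * Hm * (101 * Q.+1%:R + 20 * (r%:R / L%:R))) <= Dm * Hm * (16 * (s + c)).
  have rhs0 : 0 <= Dm * Hm * (16 * (s + c)).
    by rewrite mulr_ge0 ?(le_trans ler01 h4)// mulr_ge0// addr_ge0// ltW.
  rewrite -[leRHS]ger0_norm// -sqrtr_sqr ler_wsqrtr// [leRHS]exprMn.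
  apply: ler_pM => //; first by rewrite (le_trans ler01).
  by rewrite expr2 ler_peMl// (le_trans ler01).
apply: (@le_trans _ _ (96 * c + 8 * (Dm * Hm * (16 * (s + c))))).
  by rewrite lerD// ler_pM2l.
have -> : 96 * c + 8 * (Dm * Hm * (16 * (s + c))) = 96 * c + 128 * (Dm * Hm * (c + s)) by ring.
by apply: absorb_weyl => //; exact: ltW.
Qed.

End NearCount.

(** * The theorem *)

Lemma modulus_sqrE (R : realType) (z : R[i]%C) :
  modulus z ^+ 2 = complex.Re z ^+ 2 + complex.Im z ^+ 2.
Proof. by rewrite /modulus normc_def /= sqr_sqrtr// addr_ge0 ?sqr_ge0. Qed.

(** The shift by M contributes a common factor e(M x) of modulus 1, so M survives only in the
    coefficients. *)
Lemma expsum_sqrE (R : realType) (M : int) (N : nat) (a : int -> R[i]%C) (x : R)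
    (u := fun k : nat => complex.Re (a (M + k%:Z))) (v := fun k : nat => complex.Im (a (M + k%:Z))) :
  modulus (expsum M N a x) ^+ 2 =
  (\sum_(1 <= k < N.+1) (u k * cos (2 * pi * (k%:R * x)) - v k * sin (2 * pi * (k%:R * x)))) ^+ 2 +
  (\sum_(1 <= k < N.+1) (v k * cos (2 * pi * (k%:R * x)) + u k * sin (2 * pi * (k%:R * x)))) ^+ 2.
Proof.
set P := \sum_(_ <= _ < _) _; set S := \sum_(_ <= _ < _) _.
pose th := 2 * pi * (M%:~R * x).
have ReD : {morph @complex.Re R : z w / z + w} by case=> ? ? [].
have ImD : {morph @complex.Im R : z w / z + w} by case=> ? ? [].
have angle k : 2 * pi * (x * (M + k%:Z)%:~R) = th + 2 * pi * (k%:R * x).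
  by rewrite /th intrD -pmulrn; ring.
have ReE : complex.Re (expsum M N a x) = cos th * P - sin th * S.
  rewrite /expsum (big_morph _ ReD (erefl _)) !mulr_sumr -sumrB; apply: eq_bigr => k _.
  rewrite /u /v /circ; case: (a _) => r s /=; rewrite angle cosD sinD; ring.
have ImE : complex.Im (expsum M N a x) = sin th * P + cos th * S.
  rewrite /expsum (big_morph _ ImD (erefl _)) !mulr_sumr -big_split; apply: eq_bigr => k _.
  rewrite /u /v /circ; case: (a _) => r s /=; rewrite angle cosD sinD; ring.
rewrite modulus_sqrE ReE ImE.
transitivity ((cos th ^+ 2 + sin th ^+ 2) * (P ^+ 2 + S ^+ 2)); first by ring.
by rewrite cos2Dsin2 mul1r.
Qed.

(** A pair i stands for q = i.1 + 1 and b = i.2 + 1. The lift b + t q^2 stays coprime to q, and it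
    determines b because 1 <= b <= q^2. *)
Lemma farey_near_count (R : realType) (Q N : nat) (y Dm Hm : R)
    (A := [set i : 'I_Q * 'I_(Q ^ 2) | (i.2 < i.1.+1 ^ 2)%N && coprime i.2.+1 i.1.+1
       && `[< exists t : int, `|i.2.+1%:R / (i.1.+1 ^ 2)%:R + t%:~R - y| <= N%:R^-1 >]]) :
  (0 < Q)%N -> (0 < N)%N -> 1 <= Dm -> 1 <= Hm ->
  (forall k, (0 < k <= 5 * (Q * N) ^ 2)%N -> (size (divisors k))%:R <= Dm) ->
  \sum_(1 <= d < (5 * (Q * N) ^ 2).+1) d%:R^-1 <= Hm ->
  #|A|%:R <= 250 * (Dm * Hm) *
    (1 + Q%:R ^+ 3 / N%:R + Num.min (Num.sqrt Q%:R) (Q%:R ^+ 2 / Num.sqrt N%:R)).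
Proof.
move=> Q0 N0 D1 H1 HD HH.
pose S (i : 'I_Q * 'I_(Q ^ 2)) (t : int) : Prop :=
  `|i.2.+1%:R / (i.1.+1 ^ 2)%:R + t%:~R - y| <= N%:R^-1.
pose t i : int := xget 0 (S i).
pose q (i : 'I_Q * 'I_(Q ^ 2)) : nat := i.1.+1.
pose a (i : 'I_Q * 'I_(Q ^ 2)) : int := i.2.+1%:Z + t i * (q i ^ 2)%:Z.
have AP i : i \in A -> [/\ (i.2 < q i ^ 2)%N, coprime i.2.+1 (q i) &
    `|i.2.+1%:R / (q i ^ 2)%:R + (t i)%:~R - y| <= N%:R^-1].
  by rewrite inE => /andP[/andP[-> ->]] /asboolP ex; split => //; apply: (xgetPex (P := S i) 0 ex).
have inj : {in A &, forall i j, q i = q j -> a i = a j -> i = j}.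
  move=> i j /AP[hi _ _] /AP[hj _ _] qij; rewrite /a qij => e.
  have : (i.2%:Z = j.2%:Z %[mod (q j ^ 2)%:Z])%Z.
    apply/eqP; rewrite eqz_mod_dvd; apply/dvdzP; exists (t j - t i).
    move: e; rewrite mulrBl -(addn1 i.2) -(addn1 j.2) !PoszD.
    move: (t i * _) (t j * _) => u v e.
    have -> : v = i.2%:Z + 1 + u - (j.2%:Z + 1) by rewrite e addrAC subrr add0r.
    by ring.
  rewrite !modz_nat -{1}qij !modn_small// => -[e2].
  rewrite (surjective_pairing i) (surjective_pairing j); congr pair; apply: val_inj => //.
  by case: qij.
have qQ : {in A, forall i, (0 < q i <= Q)%N} by move=> i _; rewrite /q /= ltn_ord.
have cop : {in A, forall i, coprimez (a i) (q i)}.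
  move=> i /AP[_ c _]; rewrite /coprimez gcdzC /a addrC -mulnn PoszM mulrA gcdzMDl.
  by rewrite gcdzC -/(coprimez _ _) coprimezE; exact: c.
have near : {in A, forall i, `|(a i)%:~R - y * (q i)%:R ^+ 2| <= (q i)%:R ^+ 2 / N%:R}.
  move=> i /AP[_ _ h].
  have q0 : 0 < (q i)%:R ^+ 2 :> R by rewrite exprn_gt0 ?ltr0n.
  have -> : (a i)%:~R - y * (q i)%:R ^+ 2 =
      (q i)%:R ^+ 2 * (i.2.+1%:R / (q i ^ 2)%:R + (t i)%:~R - y).
    by rewrite /a intrD intrM -!pmulrn natrX; field; rewrite pnatr_eq0.
  by rewrite normrM gtr0_norm// ler_pM2l.
have hN := near_count_sqrtN Q0 N0 inj qQ cop near D1 H1 HD.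
have hQ := near_count_sqrtQ Q0 N0 inj qQ cop near D1 H1 HD HH.
by rewrite /Num.min; case: ifP.
Qed.

Theorem theorem1 (R : realType) (eps : R) (heps : 0 < eps) :
  exists2 C : R, 0 < C &
    forall (M : int) (Q N : nat) (a : int -> R[i]%C),
      \sum_(1 <= q < Q.+1) \sum_(1 <= b < (q ^ 2).+1 | coprime b q)
          modulus (expsum M N a (b%:R / (q ^ 2)%:R)) ^+ 2
      <= C * powR (Q * N)%:R eps
           * (Q%:R ^+ 3 + N%:R
              + Num.min (N%:R * Num.sqrt Q%:R) (Num.sqrt N%:R * Q%:R ^+ 2))
           * sqnorm M N a.
Proof.
(* The divisor and harmonic bounds are each taken at 5 (QN)^2, so each costs (QN)^(eps/2). *)
pose e := eps / 4; have e0 : 0 < e by rewrite divr_gt0.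
have [C1 C1ge C1P] := divisors_bound e0.
have [C2 C2ge C2P] := harmonic_bound e0.
pose F := powR (5 : R) e; have F1 : 1 <= F by rewrite -[leLHS](powRr0 5) ler_powR ?ler1n ?(ltW e0).
have F0 : 0 < F by apply: lt_le_trans F1.
have C10 : 0 < C1 by apply: lt_le_trans C1ge.
(* 32 comes from the large sieve and 250 from the count; [C2 + 1] ensures [1 <= Hm]. *)
exists (32 * 250 * (C1 * F * ((C2 + 1) * F))); first by rewrite !mulr_gt0// ltr_wpDl.
move=> M Q N a.
have Z0 : 0 <= sqnorm M N a by apply: sumr_ge0 => k _; apply: sqr_ge0.
have min0 : 0 <= Num.min (N%:R * Num.sqrt Q%:R) (Num.sqrt N%:R * Q%:R ^+ 2) :> R.
  by rewrite le_min !mulr_ge0 ?sqrtr_ge0 ?exprn_ge0.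
have rhs0 : 0 <= 32 * 250 * (C1 * F * ((C2 + 1) * F)) * powR (Q * N)%:R eps
    * (Q%:R ^+ 3 + N%:R + Num.min (N%:R * Num.sqrt Q%:R) (Num.sqrt N%:R * Q%:R ^+ 2)) * sqnorm M N a.
  rewrite mulr_ge0// mulr_ge0 ?addr_ge0 ?exprn_ge0//.
  by rewrite mulr_ge0 ?powR_ge0// !mulr_ge0 ?(ltW F0) ?(ltW C10)// addr_ge0.
have [Q00|Q0] := posnP Q; first by apply: le_trans rhs0; rewrite Q00 big_geq.
have [N00|N0] := posnP N.
  apply: le_trans rhs0; rewrite big1// => q _; rewrite big1// => b _.
  by rewrite N00 /expsum big_geq// modulus_sqrE /= expr0n addr0.
pose P : R := powR (Q * N)%:R (eps / 2).
have QN1 : 1 <= (Q * N)%:R :> R by rewrite ler1n muln_gt0 Q0.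
have P1 : 1 <= P by rewrite /P -[leLHS](powRr0 (Q * N)%:R) ler_powR// divr_ge0 ?ltW.
have PP : powR (Q * N)%:R eps = P * P.
  rewrite [in LHS](splitr eps) powRD//.
  by apply/implyP => _; rewrite gt_eqF// (lt_le_trans ltr01).
have pow5 : powR (5 * (Q * N) ^ 2)%:R e = F * P.
  rewrite natrM powRM//; congr (_ * _).
  rewrite natrX -powR_mulrn// -powRrM; congr powR; rewrite /e; lra.
pose Dm := C1 * (F * P); pose Hm := (C2 + 1) * (F * P).
have FP1 : 1 <= F * P by rewrite -(mulr1 1) ler_pM.
have D1 : 1 <= Dm by rewrite -(mulr1 1) ler_pM.
have H1 : 1 <= Hm by rewrite -(mulr1 1) ler_pM// lerDr.
have HD k : (0 < k <= 5 * (Q * N) ^ 2)%N -> (size (divisors k))%:R <= Dm.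
  move=> /andP[k0 kP]; apply: (le_trans (C1P k k0)); rewrite /Dm ler_pM2l// -pow5.
  by apply: ge0_ler_powR; rewrite ?nnegrE ?(ltW e0) ?ler_nat.
have HH : \sum_(1 <= d < (5 * (Q * N) ^ 2).+1) d%:R^-1 <= Hm.
  apply: (le_trans (C2P _ _)); first by rewrite muln_gt0 expn_gt0 muln_gt0 Q0 N0.
  by rewrite pow5 /Hm ler_wpM2r ?lerDl// (le_trans ler01).
pose x (i : 'I_Q * 'I_(Q ^ 2)) : R := i.2.+1%:R / (i.1.+1 ^ 2)%:R.
pose A := [set i : 'I_Q * 'I_(Q ^ 2) | (i.2 < i.1.+1 ^ 2)%N && coprime i.2.+1 i.1.+1].
have -> : \sum_(1 <= q < Q.+1) \sum_(1 <= b < (q ^ 2).+1 | coprime b q)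
    modulus (expsum M N a (b%:R / (q ^ 2)%:R)) ^+ 2 =
    \sum_(i in A) modulus (expsum M N a (x i)) ^+ 2.
  rewrite big_add1 /= big_mkord.
  (* The inner range depends on q; widening it to Q^2 places all pairs in one finite type. *)
  under [LHS]eq_bigr => q _.
    rewrite big_add1 /= big_mkord.
    rewrite (big_ord_widen_cond (Q ^ 2) (fun b => coprime b.+1 q.+1)
       (fun b => modulus (expsum M N a (b.+1%:R / (q.+1 ^ 2)%:R)) ^+ 2)) /=; last first.
      by rewrite leq_exp2r.
    over.
  rewrite pair_big_dep /=; apply: eq_bigl => i; rewrite inE andbC //.
under eq_bigr => i _ do rewrite expsum_sqrE.
pose K := 250 * (Dm * Hm) *
    (1 + Q%:R ^+ 3 / N%:R + Num.min (Num.sqrt Q%:R) (Q%:R ^+ 2 / Num.sqrt N%:R)).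
have N0R : 0 < N%:R :> R by rewrite ltr0n.
have K0 : 0 < K.
  rewrite /K; apply: mulr_gt0; first exact: (mulr_gt0 _ (mulr_gt0 (lt_le_trans ltr01 D1) (lt_le_trans ltr01 H1))).
  apply: (lt_le_trans ltr01); rewrite -addrA lerDl addr_ge0 ?divr_ge0 ?exprn_ge0//.
have HK y : #|[set i in A | `[< exists t : int, `|x i + t%:~R - y| <= N%:R^-1 >]]|%:R <= K.
  apply: le_trans (farey_near_count y Q0 N0 D1 H1 HD HH); rewrite ler_nat.
  by apply: subset_leq_card; apply/fintype.subsetP => i; rewrite !inE.
apply: (le_trans (large_sieve_real _ _ N0 K0 HK)).
have ZE : sqnorm M N a = \sum_(1 <= k < N.+1)
    (complex.Re (a (M + k%:Z)) ^+ 2 + complex.Im (a (M + k%:Z)) ^+ 2).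
  by apply: eq_bigr => k _; rewrite modulus_sqrE.
rewrite -ZE; apply: ler_wpM2r => //.
have NK : (1 + Q%:R ^+ 3 / N%:R + Num.min (Num.sqrt Q%:R) (Q%:R ^+ 2 / Num.sqrt N%:R)) * N%:R
  = Q%:R ^+ 3 + N%:R + Num.min (N%:R * Num.sqrt Q%:R) (Num.sqrt N%:R * Q%:R ^+ 2) :> R.
  rewrite !mulrDl mul1r divfK ?gt_eqF// minr_pMl ?ltW//.
  rewrite [Num.sqrt Q%:R * _]mulrC (_ : Q%:R ^+ 2 / Num.sqrt N%:R * N%:R = Num.sqrt N%:R * Q%:R ^+ 2).
    by rewrite [N%:R + _]addrC.
  rewrite -{2}(sqr_sqrtr (ltW N0R)); field; rewrite gt_eqF// sqrtr_gt0//.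
rewrite -NK PP le_eqVlt; apply/orP; left; apply/eqP; rewrite /K /Dm /Hm; ring.
Qed.
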